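(* Let $f:(A,\mathfrak{m})\to(B,\mathfrak{n})$ be a Dumitrescu local homomorphism between noetherian local rings of characteristic $p$. If $A$ is regular, then $f$ is flat.
   Context: $p$ is a prime number; rings of characteristic $p$ are $\mathbb{F}_p$-algebras. An $A$-linear map $M\to M'$ is $A$-pure if $W\otimes_A M\to W\otimes_A M'$ is injective for every $A$-module $W$. For a homomorphism $f:A\to B$ of $\mathbb{F}_p$-algebras and $e\ge 0$, let $A^{(e)}$, $B^{(e)}$ be copies of the rings $A$, $B$, with $B^{(e)}$ an $A^{(e)}$-algebra via $f$ and $A$ an $A^{(e)}$-algebra via $a^{(e)}\mapsto a^{p^e}$. The $e$th Radu--André homomorphism is $\Phi_e(A,B): B^{(e)}\otimes_{A^{(e)}}A\to B$, $b^{(e)}\otimes a\mapsto b^{p^e}f(a)$; it is $A$-linear when $A$ acts on the source through the second tensor factor and on $B$ via $f$. The map $f$ is Dumitrescu if $\Phi_e(A,B)$ is pure as an $A$-linear map for every $e>0$. *)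

(* Defs.v *)
From HB Require Import structures.
From mathcomp Require Import all_boot all_algebra.
From mathcomp Require Import boolp.
From mathcomp.multinomials Require Import freeg.

Set Implicit Arguments.
Unset Strict Implicit.
Unset Printing Implicit Defensive.

Import GRing.Theory.
Local Open Scope ring_scope.
Local Open Scope quotient_scope.

(* Classical logic (boolp) is used throughout, so that {pred A} ranges over   *)
(* all subsets of A.                                                          *)

Section Ideals.
Variable A : comNzRingType.
Implicit Types I J m : {pred A}.

Definition ideal I := GRing.submod_closed (I : {pred A^o}).

(* idealr_closed already contains 1 \notin I. *)
Definition prime_ideal I := idealr_closed I /\ prime_idealr_closed I.

Definition maximal_ideal I :=
  idealr_closed I /\ forall J, idealr_closed J -> {subset I <= J} -> J =i I.

Definition generates (d : nat) (x : 'I_d -> A) I :=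
  forall a, a \in I <-> exists c : 'I_d -> A, a = \sum_(i < d) c i * x i.

Definition noetherian :=
  forall I, ideal I -> exists d (x : 'I_d -> A), generates x I.

Definition local_ring m :=
  maximal_ideal m /\ forall J, maximal_ideal J -> J =i m.

(* A chain P 0 < ... < P d of length d; the values P i for i > d are junk. *)
Definition has_prime_chain (d : nat) :=
  exists P : nat -> {pred A},
    (forall i, (i <= d)%N -> prime_ideal (P i)) /\
    (forall i, (i < d)%N ->
       {subset P i <= P i.+1} /\ ~ {subset P i.+1 <= P i}).

Definition krull_dim (d : nat) :=
  has_prime_chain d /\ forall k, has_prime_chain k -> (k <= d)%N.

Definition regular_local_ring m :=
  [/\ noetherian, local_ring m
    & exists d, krull_dim d /\ exists x : 'I_d -> A, generates x m].

End Ideals.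

Definition local_hom (A B : comNzRingType) (m : {pred A}) (n : {pred B})
  (f : {rmorphism A -> B}) := forall a, a \in m -> f a \in n.

(* The S-module M regarded as an R-module via f. *)
Definition resscal (R S : comNzRingType) (f : {rmorphism R -> S})
  (M : lmodType S) : Type := M.

Section RestrictionOfScalars.
Variables (R S : comNzRingType) (f : {rmorphism R -> S}) (M : lmodType S).
Local Notation resM := (resscal f M).

HB.instance Definition _ := GRing.Zmodule.copy resM M.

Let scale (a : R) (x : resM) : resM := f a *: (x : M).

Let scaleA a b v : scale a (scale b v) = scale (a * b) v.
Proof. by rewrite /scale scalerA rmorphM. Qed.
Let scale1 : left_id 1 scale.
Proof. by move=> v; rewrite /scale rmorph1 scale1r. Qed.
Let scaleDr : right_distributive scale +%R.
Proof. by move=> a u v; rewrite /scale scalerDr. Qed.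
Let scaleDl v : {morph scale^~ v : a b / a + b}.
Proof. by move=> a b; rewrite /scale rmorphD scalerDl. Qed.

HB.instance Definition _ :=
  GRing.Zmodule_isLmodule.Build R resM scaleA scale1 scaleDr scaleDl.

Lemma resscalE (a : R) (x : resM) : a *: x = (f a *: (x : M) : M).
Proof. by []. Qed.
End RestrictionOfScalars.

(* For a ring map phi : R -> S, an R-module M and an S-module N, the tensor   *)
(* product of M and N over R (N being an R-module via phi), as an S-module    *)
(* via the second factor.  It is the free abelian group on M * N modulo the   *)
(* subgroup tens_rel.  The usual tensor product of two R-modules is the case  *)
(* phi = idfun.                                                               *)
Section Tensor.
Variables (R S : comNzRingType) (phi : {rmorphism R -> S}).
Variables (M : lmodType R) (N : lmodType S).

Local Notation F := {freeg (M * N)%type}.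
Local Notation gen m n := (<< (m, n) >> : F).

Inductive tens_rel : F -> Prop :=
| tens_rel0 : tens_rel 0
| tens_relB x y : tens_rel x -> tens_rel y -> tens_rel (x - y)
| tens_relDl m m' n : tens_rel (gen (m + m') n - gen m n - gen m' n)
| tens_relDr m n n' : tens_rel (gen m (n + n') - gen m n - gen m n')
| tens_relZ a m n : tens_rel (gen (a *: m) n - gen m (phi a *: n)).

Definition tens_pred : {pred F} := fun x => `[< tens_rel x >].

Fact tens_pred_zmod : zmod_closed tens_pred.
Proof.
split; first exact/asboolP/tens_rel0.
by move=> x y /asboolP xr /asboolP yr; apply/asboolP/tens_relB.
Qed.
HB.instance Definition _ := GRing.isZmodClosed.Build F tens_pred tens_pred_zmod.

Definition tens : Type := {ideal_quot tens_pred}.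
HB.instance Definition _ := GRing.Zmodule.on tens.

Definition tpure (m : M) (n : N) : tens := \pi_{ideal_quot tens_pred} (gen m n).
Local Notation "m ⊗ n" := (tpure m n) (at level 40).

(* The additive map induced by a balanced biadditive map g, i.e. the one      *)
(* sending m ⊗ n to g m n; zmodule P is P as a module over int.                *)
Definition tlift (P : zmodType) (g : M -> N -> P) (t : tens) : P :=
  fglift (fun z : (M * N)%type => g z.1 z.2 : zmodule P)
    (repr (t : {ideal_quot tens_pred})).

Definition balanced (P : zmodType) (g : M -> N -> P) :=
  [/\ forall m m' n, g (m + m') n = g m n + g m' n,
      forall m n n', g m (n + n') = g m n + g m n'
    & forall a m n, g (a *: m) n = g m (phi a *: n)].

Section Lift.
Variables (P : zmodType) (g : M -> N -> P).
Hypothesis bal_g : balanced g.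
Let h : F -> zmodule P := fglift (fun z : (M * N)%type => g z.1 z.2 : zmodule P).

Let hB x y : h (x - y) = h x - h y.
Proof. exact: lift_is_additive. Qed.
Let hU m n : h (gen m n) = g m n.
Proof. by rewrite /h liftU scale1r. Qed.

Let h_rel x : tens_rel x -> h x = 0.
Proof.
have [gDl gDr gZ] := bal_g.
elim=> [|{}x y _ hx _ hy|m m' n|m n n'|a m n].
- by rewrite -(subrr (0 : F)) hB subrr.
- by rewrite hB hx hy subr0.
- by rewrite !hB !hU gDl (addrC (g m n)) addrK subrr.
- by rewrite !hB !hU gDr (addrC (g m n)) addrK subrr.
- by rewrite !hB !hU gZ subrr.
Qed.

Let tlift_pi x : tlift g (\pi_{ideal_quot tens_pred} x) = h x.
Proof.
apply/eqP; rewrite -subr_eq0; apply/eqP; rewrite /tlift -[LHS]hB.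
apply: h_rel; apply/asboolP.
by rewrite -[X in is_true X]/(_ \in tens_pred) Quotient.idealrBE reprK.
Qed.

Lemma tlift_tpure m n : tlift g (m ⊗ n) = g m n.
Proof. by rewrite tlift_pi hU. Qed.

Lemma tliftB : {morph tlift g : x y / x - y}.
Proof.
move=> x y; rewrite -[x]reprK -[y]reprK.
by rewrite -[X in tlift g X]raddfB !tlift_pi hB.
Qed.
End Lift.

Lemma tpureDl m m' n : (m + m') ⊗ n = m ⊗ n + m' ⊗ n.
Proof.
apply/eqP; rewrite -raddfD /= -Quotient.idealrBE opprD addrA.
exact/asboolP/tens_relDl.
Qed.

Lemma tpureDr m n n' : m ⊗ (n + n') = m ⊗ n + m ⊗ n'.
Proof.
apply/eqP; rewrite -raddfD /= -Quotient.idealrBE opprD addrA.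
exact/asboolP/tens_relDr.
Qed.

Lemma tpureZ a m n : (a *: m) ⊗ n = m ⊗ (phi a *: n).
Proof. by apply/eqP; rewrite -Quotient.idealrBE; apply/asboolP/tens_relZ. Qed.

Lemma tpure0l n : 0 ⊗ n = 0.
Proof. by apply: (addIr (0 ⊗ n)); rewrite -tpureDl !add0r. Qed.

Lemma tpureNl m n : (- m) ⊗ n = - (m ⊗ n).
Proof. by apply: (addIr (m ⊗ n)); rewrite -tpureDl !addNr tpure0l. Qed.

Lemma tens_ind (Q : tens -> Prop) :
  (forall m n, Q (m ⊗ n)) -> Q 0 -> (forall x y, Q x -> Q y -> Q (x - y)) ->
  forall t, Q t.
Proof.
move=> Qp Q0 QB t.
have QN x : Q x -> Q (- x) by move=> Qx; rewrite -[- x]add0r; apply: QB.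
have QD x y : Q x -> Q y -> Q (x + y).
  by move=> Qx Qy; rewrite -[y]opprK; apply/QB/QN.
rewrite -[t]reprK -(freeg_sumE (repr (t : {ideal_quot tens_pred}))) raddf_sum.
elim/big_ind: _ => // -[m n] _; set c := coeff _ _.
have -> : << c *g (m, n) >> = gen m n *~ c :> F by rewrite freegU_mulz intz.
have Qn k : Q (m ⊗ n *+ k).
  by elim: k => [|k IHk]; rewrite ?mulr0n// mulrS; apply: QD.
rewrite raddfMz /=; case: c => k; first by rewrite -pmulrn.
by rewrite NegzE mulrNz -pmulrn; apply: QN.
Qed.

Let gscale (s : S) m n := m ⊗ (s *: n).

Let gscale_bal s : balanced (gscale s).
Proof.
split=> [m m' n|m n n'|a m n]; rewrite /gscale ?tpureDl ?scalerDr ?tpureDr//.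
by rewrite tpureZ !scalerA mulrC.
Qed.

Let scale (s : S) : tens -> tens := tlift (gscale s).

Let scaleE s m n : scale s (m ⊗ n) = m ⊗ (s *: n).
Proof. exact/tlift_tpure/gscale_bal. Qed.
Let scaleB s : {morph scale s : x y / x - y}.
Proof. exact/tliftB/gscale_bal. Qed.
Let scale0 s : scale s 0 = 0.
Proof. by have := scaleB s 0 0; rewrite !subrr. Qed.
Let scaleA a b v : scale a (scale b v) = scale (a * b) v.
Proof.
elim/tens_ind: v => [m n||x y hx hy]; rewrite ?scale0 //.
- by rewrite !scaleE scalerA.
- by rewrite !scaleB hx hy.
Qed.
Let scale1 : left_id 1 scale.
Proof.
move=> v; elim/tens_ind: v => [m n||x y hx hy]; rewrite ?scale0 //.
- by rewrite !scaleE scale1r.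
- by rewrite !scaleB hx hy.
Qed.
Let scaleDr : right_distributive scale +%R.
Proof.
move=> a u v; rewrite -[in LHS](opprK v) scaleB -(sub0r v) scaleB scale0.
by rewrite sub0r opprK.
Qed.
Let scaleDl v : {morph scale^~ v : a b / a + b}.
Proof.
move=> a b; elim/tens_ind: v => [m n||x y hx hy]; rewrite ?scale0 ?addr0 //.
- by rewrite !scaleE scalerDl tpureDr.
- by rewrite !scaleB hx hy opprD addrACA.
Qed.

HB.instance Definition _ :=
  GRing.Zmodule_isLmodule.Build S tens scaleA scale1 scaleDr scaleDl.

Lemma tpureZr s m n : s *: (m ⊗ n) = m ⊗ (s *: n).
Proof. exact: scaleE. Qed.

Lemma tlift_linear (P : lmodType S) (g : M -> N -> P) :
  balanced g -> (forall s m n, g m (s *: n) = s *: g m n) -> linear (tlift g).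
Proof.
move=> bg gZ.
have l0 : tlift g 0 = 0 by have := tliftB bg 0 0; rewrite !subrr.
have lN x : tlift g (- x) = - tlift g x.
  by have := tliftB bg 0 x; rewrite l0 !sub0r.
have lD x y : tlift g (x + y) = tlift g x + tlift g y.
  by have := tliftB bg x (- y); rewrite lN !opprK.
move=> s x y; rewrite lD; congr (_ + _).
elim/tens_ind: x => [m n||u v hu hv]; first 1 last.
- by rewrite scaler0 l0 scaler0.
- by rewrite scalerBr !tliftB// hu hv scalerBr.
- by rewrite tpureZr !tlift_tpure// gZ.
Qed.
End Tensor.

Section TensorMap.
Variables (R S : comNzRingType) (phi : {rmorphism R -> S}).
Variables (M : lmodType R) (N N' : lmodType S) (g : {linear N -> N'}).

Let pre (m : M) (n : N) : tens phi M N' := tpure phi m (g n).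

Let pre_balanced : balanced phi pre.
Proof.
split=> *; rewrite /pre ?tpureDl ?linearD ?tpureDr//=.
by rewrite tpureZ linearZ.
Qed.

(* The map id_M ⊗ g. *)
Definition tens_map : tens phi M N -> tens phi M N' := tlift pre.

Lemma tens_map_tpure m n : tens_map (tpure phi m n) = tpure phi m (g n).
Proof. exact: tlift_tpure pre_balanced _ _. Qed.

Let tens_map_linear : linear tens_map.
Proof. by apply: tlift_linear => // s m n; rewrite /pre linearZ tpureZr. Qed.
HB.instance Definition _ :=
  GRing.isLinear.Build S (tens phi M N) (tens phi M N') *:%R tens_map
    tens_map_linear.
End TensorMap.
Arguments tens_map {R S} phi M {N N'} g.

Section PurityFlatness.
Variable A : comNzRingType.

Definition pure (M M' : lmodType A) (g : {linear M -> M'}) :=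
  forall W : lmodType A, injective (tens_map idfun W g).

Definition flat (M : lmodType A) :=
  forall (N N' : lmodType A) (g : {linear N -> N'}),
    injective g -> injective (tens_map idfun M g).
End PurityFlatness.

Definition flat_hom (A B : comNzRingType) (f : {rmorphism A -> B}) :=
  flat (resscal f B^o).

(* a |-> a ^+ (p ^ e), the structure map of A as an A^(e)-algebra. *)
Definition frobenius (p : nat) (A : comNzRingType) of p \in [pchar A] :=
  fun (e : nat) (a : A) => a ^+ (p ^ e).

Section Frobenius.
Variables (p : nat) (A : comNzRingType) (chA : p \in [pchar A]) (e : nat).

Let frob_zmod : zmod_morphism (frobenius chA e).
Proof.
move=> a b; rewrite /frobenius; elim: e => [|k IHk]; first by rewrite !expr1.
by rewrite expnSr !exprM IHk -!(pFrobenius_autE chA) rmorphB.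
Qed.
Let frob_monoid : monoid_morphism (frobenius chA e).
Proof. by split=> [|a b]; rewrite /frobenius ?expr1n ?exprMn. Qed.
HB.instance Definition _ :=
  GRing.isZmodMorphism.Build A A (frobenius chA e) frob_zmod.
HB.instance Definition _ :=
  GRing.isMonoidMorphism.Build A A (frobenius chA e) frob_monoid.
End Frobenius.

Section RaduAndre.
Variables (p : nat) (A B : comNzRingType).
Variables (chA : p \in [pchar A]) (f : {rmorphism A -> B}) (e : nat).

(* B^(e) ⊗_{A^(e)} A, an A-module via the second factor. *)
Definition radu_andre_source : lmodType A :=
  tens (frobenius chA e) (resscal f B^o) A^o.

Let pre (b : resscal f B^o) (a : A^o) : resscal f B^o :=
  (b : B) ^+ (p ^ e) * f a.

Let pre_balanced : balanced (frobenius chA e) pre.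
Proof.
split=> [b b' a|b a a'|c b a]; rewrite /pre.
- have -> : ((b + b' : resscal f B^o) : B) ^+ (p ^ e)
      = (b : B) ^+ (p ^ e) + (b' : B) ^+ (p ^ e).
    exact: (rmorphD (frobenius (rmorph_pchar f chA) e)).
  exact: (@mulrDl B).
- by rewrite rmorphD; exact: (@mulrDr B).
- rewrite resscalE /= /GRing.scale /= exprMn /frobenius rmorphM rmorphXn.
  by rewrite mulrCA mulrA.
Qed.

(* The e-th Radu-Andre homomorphism, b ⊗ a |-> b ^+ (p ^ e) * f a. *)
Definition radu_andre : radu_andre_source -> resscal f B^o := tlift pre.

Lemma radu_andre_tpure (b : B) (a : A) :
  radu_andre (tpure (frobenius chA e) (b : resscal f B^o) (a : A^o))
  = b ^+ (p ^ e) * f a.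
Proof. exact: tlift_tpure pre_balanced _ _. Qed.

Let radu_andre_linear : linear radu_andre.
Proof.
apply: tlift_linear => // s b a.
rewrite /pre resscalE /GRing.scale /= rmorphM; exact: mulrCA.
Qed.
HB.instance Definition _ :=
  GRing.isLinear.Build A radu_andre_source (resscal f B^o) *:%R radu_andre
    radu_andre_linear.
End RaduAndre.
Arguments radu_andre {p A B} chA f e.

Definition dumitrescu (p : nat) (A B : comNzRingType)
  (chA : p \in [pchar A]) (f : {rmorphism A -> B}) :=
  forall e, (0 < e)%N -> pure (radu_andre chA f e).

(* Main.v *)
(* Write m = (x_1, ..., x_d) with d = dim A and J_j = (x_1, ..., x_j); the     *)
(* x_i form a regular sequence in A.  Flatness is handled in equational form, *)
(* and descends from J_(j+1) to J_j when x_(j+1) is regular modulo J_j, by    *)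
(* Krull's intersection theorem.  Applied to the Frobenius F this makes A/J_j *)
(* flat over itself via F (Kunz), and applied to f it reduces the theorem to  *)
(* the regularity of x_(j+1) on B/J_jB.  If b x_(j+1) lies in J_jB, then      *)
(* b^q x_(j+1) = 0 in B/J_jB, so by purity of Phi_e, tensored with A/J_j,     *)
(* b (x) x_(j+1) = 0 in B (x)_F A/J_j.  Flatness of A/J_j over A via F puts   *)
(* x_(j+1) in J_j + I^[q], where I is the annihilator of b in B/J_jB.         *)
(* If b were nonzero, I would be contained in m, and x_(j+1) would lie in the *)
(* ideal generated by the other x_i.                                          *)

Require Import Defs.
From HB Require Import structures.
From mathcomp Require Import all_boot all_algebra.
From mathcomp Require Import boolp ring.
From mathcomp.multinomials Require Import freeg.

Set Implicit Arguments.
Unset Strict Implicit.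
Unset Printing Implicit Defensive.

Import GRing.Theory.
Local Open Scope ring_scope.
Local Open Scope quotient_scope.

(** * Chain conditions and Nakayama's lemma *)

(** Take as many generators of [m] as the dimension of [A]. By Krull's height theorem they form a
    regular sequence and none of them lies in the ideal generated by the others
    ([regular_seq_chain]). Flatness of [B/K] over [A/J] is handled as [eqflat]: every solution in
    [B/K] of a linear equation over [A/J] is a combination of solutions from [A/J]. When [J = m] the
    base is a field and this is plain ([eqflat_local]). The generators are then removed one at a
    time: [eqflat_lift] is a local criterion of flatness, passing from [J + (x)] to [J] once [x] is
    regular on [B/K]. At [J = 0], [eqflat_flat_hom] converts [eqflat] into flatness.

    Everything thus rests on the regularity of each generator [y] on [B/JB] ([extension_regular]),
    and this is where purity enters. Let [q = p^e] and suppose that [b f(y)] lies in [JB]. Then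
    [b^q f(y)] is zero in [B/JB], so by purity [b ⊗ y] vanishes in [B ⊗_F A/J], where [F] is the
    [e]-th power of Frobenius. The same descent shows that [F] is flat on [A/J] ([frobenius_eqflat],
    one direction of Kunz's theorem). Hence [y] is, modulo [J], a combination of powers [u_j^q] with
    [u_j b] in [JB] ([pure_radu_andre_relations]). If [b] were not in [JB], every [u_j] would be a
    nonunit; as [q >= 2], [y] would lie in [L + (y^2)], with [L] generated by [J] and the remaining
    generators. Since [1 - c y] is a unit, [y] would lie in [L], contrary to irredundancy. *)

Section Submodules.
Variables (R : comNzRingType) (V : lmodType R).
Implicit Types (S : V -> Prop) (u v : V).

Definition submodule S := S 0 /\ forall a u v, S u -> S v -> S (a *: u + v).

Definition acc := forall C : nat -> V -> Prop,
  (forall k, submodule (C k)) -> (forall k v, C k v -> C k.+1 v) ->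
  exists N, forall k v, C k v -> C N v.

Lemma smD S u v : submodule S -> S u -> S v -> S (u + v).
Proof. by case=> _ /(_ 1 u v); rewrite scale1r. Qed.

Lemma smZ S a v : submodule S -> S v -> S (a *: v).
Proof. by case=> S0 /(_ a v 0) + Sv; rewrite addr0; apply. Qed.

Lemma smN S v : submodule S -> S v -> S (- v).
Proof. by move=> sS Sv; rewrite -scaleN1r; apply: smZ. Qed.

Lemma smB S u v : submodule S -> S u -> S v -> S (u - v).
Proof. by move=> sS Su Sv; apply: smD => //; apply: smN. Qed.

Lemma sm_sum S (I : Type) (r : seq I) (P : pred I) (F : I -> V) :
  submodule S -> (forall i, P i -> S (F i)) -> S (\sum_(i <- r | P i) F i).
Proof. by move=> sS SF; elim/big_ind: _ => //; [case: sS|move=> *; apply: smD].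
  Qed.

Lemma sm_congr S u v : submodule S -> S (u - v) -> S v -> S u.
Proof. by move=> sS Suv Sv; rewrite -(subrK v u); apply: smD. Qed.

End Submodules.

Lemma chain_le (T : Type) (C : nat -> T -> Prop) :
  (forall k v, C k v -> C k.+1 v) -> forall i j v, (i <= j)%N -> C i v -> C j v.
Proof.
move=> incC i j v /subnK <-; elim: (j - i)%N => // k IHk Civ.
by rewrite addSn; apply/incC/IHk.
Qed.

Section Nakayama.
Variables (R : comNzRingType) (V : lmodType R) (accV : acc V).

(* [M] plays the role of the complement of a prime ideal containing [x]: the  *)
(* conclusion says that [T] vanishes in the localization of [V / S] at [M].   *)
Lemma nakayama (M : R -> Prop) (x : R) (S T : V -> Prop) :
  M 1 -> (forall s t, M s -> M t -> M (s * t)) ->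
  (forall s r, M s -> M (s - r * x)) -> submodule S ->
  (forall t, T t -> exists s t', [/\ M s, T t' & S (s *: t - x *: t')]) ->
  forall t, T t -> exists s, M s /\ S (s *: t).
Proof.
move=> M1 MM Mx sS stepT t0 Tt0.
have stepf (t : {t | T t}) : {st : R * {t | T t} |
    M st.1 /\ S (st.1 *: sval t - x *: sval st.2)}.
  apply: cid; case: t => t Tt; have [s [t' [Ms Tt' Sst]]] := stepT t Tt.
  by exists (s, exist _ t' Tt').
pose a := fix a k : {t | T t} :=
  if k is k'.+1 then (sval (stepf (a k'))).2 else exist _ t0 Tt0.
pose s k := (sval (stepf (a k))).1.
have Ms k : M (s k) by have [] := svalP (stepf (a k)).
have Sa k : S (s k *: sval (a k) - x *: sval (a k.+1)).
  by have [] := svalP (stepf (a k)).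
(* [C k] is the contraction of the submodule generated by [a k] in the localization of [V / S] at
   [M]. It grows with [k] because [s k] times [a k] is [x] times [a k.+1]. Once it is stationary,
   [a N.+1] is a multiple of [a N], hence of [x] times itself, and so vanishes there; [van] carries
   this back to [t0]. *)
pose C k v := exists s r, M s /\ S (s *: v - r *: sval (a k)).
have [k|k v [s1 [r [Ms1 Sv]]]|N CN] := accV (C := C).
- split=> [|b u v [s1 [r1 [Ms1 Su]]] [s2 [r2 [Ms2 Sv]]]].
    by exists 1, 0; rewrite scaler0 scale0r subr0; case: sS.
  exists (s1 * s2), (s2 * b * r1 + s1 * r2); split; first exact: MM.
  have -> : (s1 * s2) *: (b *: u + v) - (s2 * b * r1 + s1 * r2) *: sval (a k)
      = (s2 * b) *: (s1 *: u - r1 *: sval (a k))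
        + s1 *: (s2 *: v - r2 *: sval (a k)).
    rewrite !scalerBr scalerDr scalerDl !scalerA opprD addrACA.
    by congr (_ *: _ - _ + _); ring.
  by apply: smD => //; apply: smZ.
- exists (s k * s1), (r * x); split; first exact: MM.
  have -> : (s k * s1) *: v - (r * x) *: sval (a k.+1)
      = s k *: (s1 *: v - r *: sval (a k))
        + r *: (s k *: sval (a k) - x *: sval (a k.+1)).
    by rewrite !scalerBr !scalerA addrA (mulrC r (s k)) subrK.
  by apply: smD => //; apply: smZ.
have [|s1 [r [Ms1 Sr]]] := CN N.+1 (sval (a N.+1)).
  by exists 1, 1; split => //; rewrite subrr; case: sS.
have van k : (exists s, M s /\ S (s *: sval (a k.+1))) ->
    exists s, M s /\ S (s *: sval (a k)).
  move=> [s' [Ms' Ss']]; exists (s' * s k); split; first exact: MM.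
  have -> : (s' * s k) *: sval (a k)
      = s' *: (s k *: sval (a k) - x *: sval (a k.+1))
        + x *: (s' *: sval (a k.+1)).
    by rewrite scalerBr !scalerA (mulrC s' x) subrK.
  by apply: smD => //; apply: smZ.
have: exists s, M s /\ S (s *: sval (a N.+1)).
  exists (s N * s1 - r * x); split; first exact/Mx/MM.
  have -> : (s N * s1 - r * x) *: sval (a N.+1)
      = s N *: (s1 *: sval (a N.+1) - r *: sval (a N))
        + r *: (s N *: sval (a N) - x *: sval (a N.+1)).
    by rewrite !scalerBr scalerBl !scalerA addrA (mulrC r (s N)) subrK.
  by apply: smD => //; apply: smZ.
by elim: N.+1 => // k IHk /van/IHk.
Qed.

Lemma sm_shift (S : V -> Prop) (a : R) : submodule S ->
  submodule (fun v => S (a *: v)).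
Proof.
move=> sS; split=> [|b u v Su Sv]; first by rewrite scaler0; case: sS.
have -> : a *: (b *: u + v) = b *: (a *: u) + a *: v.
  by rewrite scalerDr !scalerA mulrC.
by case: sS => _; apply.
Qed.

Lemma colon_stable (S : V -> Prop) (x : R) : submodule S ->
  exists k0, forall k v, S (x ^+ k *: v) -> S (x ^+ k0 *: v).
Proof.
move=> sS; apply: (accV (C := fun k v => S (x ^+ k *: v))) => [k|k v Sv].
  exact: sm_shift.
by rewrite exprS -scalerA; apply: smZ.
Qed.

(** Nakayama with the units as [M], applied to [T], the intersection of all [S + x^N V]. Stability
    of the colons [(S : x^k)] from [k0] on replaces the Artin-Rees lemma: if [t] is [x^(k0+1) c]
    modulo [S], then [x^k0 c] is again in [T], so [T] is contained in [S + x T]. *)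
Lemma krull_intersection (S : V -> Prop) (x : R) (t : V) :
  submodule S -> (forall r, exists s, s * (1 - r * x) = 1) ->
  (forall N, exists c, S (t - x ^+ N *: c)) -> S t.
Proof.
move=> sS unit_x Tt.
pose T t := forall N, exists c, S (t - x ^+ N *: c).
have [k0 k0P] := colon_stable x sS.
have [||||s [[b bs] Ss]] := @nakayama (fun s => exists b,
  b * s = 1) x S T _ _ _ sS _ t Tt.
- by exists 1; rewrite mul1r.
- by move=> s1 s2 [b1 e1] [b2 e2]; exists (b1 * b2);
  rewrite mulrACA e1 e2 mul1r.
- move=> s r [b bs]; have [c cP] := unit_x (b * r).
  by exists (c * b); rewrite -cP -bs; ring.
- move=> {Tt}t Tt; have [c Sc] := Tt k0.+1.
  exists 1, (x ^+ k0 *: c); split; first by exists 1; rewrite mul1r.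
    move=> N; have [d Sd] := Tt (N + k0.+1)%N; exists (x ^+ k0 *: d).
    have -> : x ^+ k0 *: c - x ^+ N *: (x ^+ k0 *: d) = x ^+ k0 *: (c - x ^+ N
      *: d).
      by rewrite scalerBr !scalerA -!exprD addnC.
    apply: (k0P k0.+1).
    have -> : x ^+ k0.+1 *: (c - x ^+ N *: d)
        = (t - x ^+ (N + k0.+1) *: d) - (t - x ^+ k0.+1 *: c).
      by rewrite scalerBr scalerA -exprD addnC opprB [RHS]addrC addrA subrK.
    exact: smB.
  by rewrite scale1r scalerA -exprS.
by have := smZ b sS Ss; rewrite scalerA bs scale1r.
Qed.

End Nakayama.

(** * Ideals, Noetherian induction and existence of primes *)

Section Ideals.
Variable R : comNzRingType.
Implicit Types (I J P : R -> Prop).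

Definition isideal I := @submodule R R^o I.

Lemma id0 I : isideal I -> I 0. Proof. by case. Qed.
Lemma idD I a b : isideal I -> I a -> I b -> I (a + b).
Proof. exact: (@smD R R^o). Qed.
Lemma idB I a b : isideal I -> I a -> I b -> I (a - b).
Proof. exact: (@smB R R^o). Qed.
Lemma idM I a b : isideal I -> I b -> I (a * b).
Proof. exact: (@smZ R R^o). Qed.
Lemma idMr I a b : isideal I -> I b -> I (b * a).
Proof. by rewrite mulrC; apply: idM. Qed.
Lemma id_sum I (T : Type) (r : seq T) (p : pred T) (F : T -> R) :
  isideal I -> (forall i, p i -> I (F i)) -> I (\sum_(i <- r | p i) F i).
Proof. exact: (@sm_sum R R^o). Qed.

Lemma isidealI I : I 0 -> (forall a b, I a -> I b -> I (a + b)) ->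
  (forall a b, I b -> I (a * b)) -> isideal I.
Proof. by move=> I0 ID IM; split=> // a u v Iu Iv; apply: ID => //; apply: IM.
  Qed.

Definition adjoin I (x : R) : R -> Prop := fun a => exists r, I (a - r * x).

Lemma adjoin_ideal I x : isideal I -> isideal (adjoin I x).
Proof.
move=> iI; apply: isidealI => [|a b [r Ir] [s Is]|a b [r Ir]].
- by exists 0; rewrite mul0r subr0; apply: id0.
- exists (r + s); rewrite mulrDl opprD addrACA; exact: idD.
- by exists (a * r); rewrite -mulrA -mulrBr; apply: idM.
Qed.

Lemma sub_adjoin I x a : I a -> adjoin I x a.
Proof. by exists 0; rewrite mul0r subr0. Qed.

Lemma adjoin_mul I x r : isideal I -> adjoin I x (r * x).
Proof. by move=> iI; exists r; rewrite subrr; apply: id0. Qed.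

Lemma adjoin_self I x : isideal I -> adjoin I x x.
Proof. by move=> iI; rewrite -[X in adjoin _ _ X]mul1r; apply: adjoin_mul. Qed.

Lemma adjoin_sub I J x : isideal J -> (forall a, I a -> J a) -> J x ->
  forall a, adjoin I x a -> J a.
Proof.
move=> iJ IJ Jx a [r /IJ Ir]; rewrite -(subrK (r * x) a).
by apply: idD => //; apply: idM.
Qed.

Lemma adjoin_mono I J x : (forall a, I a -> J a) ->
  forall a, adjoin I x a -> adjoin J x a.
Proof. by move=> IJ a [r /IJ]; exists r. Qed.

Lemma noetherian_acc : noetherian R -> acc R^o.
Proof.
move=> noeth C iC incC.
have leC := chain_le incC.
have [|d [y yP]] := noeth (fun a => `[< exists k, C k a >]).
  split=> [|a u v]; first by apply/asboolP; exists 0%N; case: (iC 0%N).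
  move=> /asboolP[i Ci] /asboolP[j Cj]; apply/asboolP; exists (maxn i j).
  case: (iC (maxn i j)) => _; apply.
    by apply: leC Ci; rewrite leq_maxl.
  by apply: leC Cj; rewrite leq_maxr.
have yC i : exists k, C k (y i).
  apply/asboolP; apply/yP; exists (fun j => (j == i)%:R).
  rewrite (bigD1 i)//= eqxx mul1r big1 ?addr0// => j /negPf ->.
  by rewrite mul0r.
have [k kP] := choice yC.
exists (\max_i k i) => j v Cv.
have /yP[c ->] : v \in (fun a => `[< exists k, C k a >]) by apply/asboolP;
  exists j.
apply: (@id_sum (C _)) => [|i _]; first exact: iC.
apply: (@idM (C _)); [exact: iC|apply: leC (kP i)].
exact: leq_bigmax.
Qed.

Lemma noetherian_ind (Q : (R -> Prop) -> Prop) : acc R^o ->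
  (forall I, isideal I ->
    (forall J, isideal J -> (forall a, I a -> J a) ->
       (exists a, J a /\ ~ I a) -> Q J) -> Q I) ->
  forall I, isideal I -> Q I.
Proof.
move=> accR step I0 iI0; apply: contrapT => nQ0.
pose bad := {I | isideal I /\ ~ Q I}.
have next (I : bad) : {J : bad | (forall a, sval I a -> sval J a) /\
    exists a, sval J a /\ ~ sval I a}.
  apply: cid; case: I => I [iI nQI] /=; apply: contrapT => no.
  apply: nQI; apply: step => // J iJ IJ [a Ja]; apply: contrapT => nQJ.
  by apply: no; exists (exist _ J (conj iJ nQJ)); split => //; exists a.
pose C := fix C k : bad :=
  if k is k'.+1 then sval (next (C k')) else exist _ I0 (conj iI0 nQ0).
have CP k := svalP (next (C k)).
have [k|k|N CN] := accR (fun k => sval (C k)).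
- by case: (svalP (C k)).
- by case: (CP k).
by case: (CP N) => _ [a [Ca nCa]]; apply/nCa/(CN N.+1).
Qed.

Definition isprime P :=
  [/\ isideal P, ~ P 1 & forall a b, P (a * b) -> P a \/ P b].

Lemma prime_avoiding I (M : R -> Prop) : acc R^o -> isideal I ->
  (forall s t, M s -> M t -> M (s * t)) -> M 1 -> (forall a, I a -> ~ M a) ->
  exists P, [/\ isprime P, forall a, I a -> P a & forall a, P a -> ~ M a].
Proof.
move=> accR + MM M1; move: I; apply: noetherian_ind => // I iI IH IM.
have [primeI|nprime] := pselect (isprime I); first by exists I.
have [a [b [Iab [nIa nIb]]]] : exists a b, I (a * b) /\ ~ I a /\ ~ I b.
  apply: contrapT => no; apply: nprime; split=> // [/IM//|a b Iab].
  apply: contrapT => /not_orP[nIa nIb]; apply: no.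
  by exists a, b; split.
have sub x : ~ I x -> (forall c, adjoin I x c -> ~ M c) ->
    exists P, [/\ isprime P, forall a, I a -> P a & forall a, P a -> ~ M a].
  move=> nIx avoid; have [||||P [pP IP PM]] := IH (adjoin I x) => //.
  - exact: adjoin_ideal.
  - by move=> c; apply: sub_adjoin.
  - by exists x; split => //; apply: adjoin_self.
  by exists P; split => // c Ic; apply/IP/sub_adjoin.
have [|meet_a] := pselect (forall c, adjoin I a c -> ~ M c);
  first exact: sub nIa.
have [|meet_b] := pselect (forall c, adjoin I b c -> ~ M c);
  first exact: sub nIb.
have [c [[r Ir] Mc]] : exists c, adjoin I a c /\ M c.
  by apply: contrapT => no; apply: meet_a => c Ic Mc; apply: no; exists c.
have [d [[s Is] Md]] : exists d, adjoin I b d /\ M d.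
  by apply: contrapT => no; apply: meet_b => c' Ic Mc'; apply: no; exists c'.
case: (IM (c * d)); last exact: MM.
have -> : c * d = d * (c - r * a) + r * a * (d - s * b) + r * s * (a * b) by
  ring.
by do !apply: idD => //; apply: idM.
Qed.

End Ideals.

(** * Chains of prime ideals *)

Section Primes.
Variables (R : comNzRingType) (accR : acc R^o).
Implicit Types (I J K P Q : R -> Prop).

Definition strict I J := (forall a, I a -> J a) /\ exists a, J a /\ ~ I a.

Lemma primeCM P s t : isprime P -> ~ P s -> ~ P t -> ~ P (s * t).
Proof. by case=> _ _ PM nPs nPt /PM[]. Qed.

Lemma primeX P a n : isprime P -> P (a ^+ n) -> P a.
Proof.
case=> _ P1 PM; elim: n => [|n IHn]; first by rewrite expr0.
by rewrite exprS => /PM[].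
Qed.

(** The contraction to [R] of [I R_P]; working with saturated ideals avoids forming
    localizations. *)
Definition sat P I : R -> Prop := fun a => exists s, ~ P s /\ I (s * a).

Lemma sub_sat P I a : isprime P -> I a -> sat P I a.
Proof. by case=> _ P1 _ Ia; exists 1; rewrite mul1r. Qed.

Lemma sat_ideal P I : isprime P -> isideal I -> isideal (sat P I).
Proof.
move=> pP iI; apply: isidealI => [|a b [s [Ps Is]] [t [Pt It]]|a b [s [Ps Is]]].
- by apply: sub_sat => //; apply: id0.
- exists (s * t); split; first exact: primeCM.
  have -> : s * t * (a + b) = t * (s * a) + s * (t * b) by ring.
  by apply: idD => //; apply: idM.
- by exists s; split=> //; rewrite mulrCA; apply: idM.
Qed.

Lemma sat_sat P I s a : isprime P -> ~ P s -> sat P I (s * a) -> sat P I a.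
Proof.
move=> pP Ps [t [Pt It]]; exists (t * s); split; first exact: primeCM.
by rewrite -mulrA.
Qed.

Definition isum I J : R -> Prop := fun a => exists b, I b /\ J (a - b).

Lemma isum_ideal I J : isideal I -> isideal J -> isideal (isum I J).
Proof.
move=> iI iJ; apply: isidealI => [|a b [c [Ic Jc]] [d [Id Jd]]|a b [c [Ic Jc]]].
- by exists 0; rewrite subr0; split; apply: id0.
- by exists (c + d); rewrite opprD addrACA; split; apply: idD.
- by exists (a * c); rewrite -mulrBr; split; apply: idM.
Qed.

(** Noetherian induction on the annihilator [(K : z)]: if some [a] in [P] does not kill [z] modulo
    [K], the last nonzero [a^i z] has a strictly larger annihilator. *)
Lemma socle K P : isideal K -> (forall a, P a -> exists N, K (a ^+ N)) ->
  ~ K 1 -> exists z, ~ K z /\ forall a, P a -> K (a * z).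
Proof.
move=> iK nilK K1.
suff main L : isideal L -> forall z, ~ K z -> (forall a, L a <-> K (a * z)) ->
    exists z, ~ K z /\ forall a, P a -> K (a * z).
  by apply: (main K iK 1 K1) => a; rewrite mulr1.
move: L; apply: noetherian_ind => // L iL IH z nKz LP.
have [sub|] := pselect (forall a, P a -> K (a * z)); first by exists z.
move=> /existsNP[a /not_implyP[Pa nKaz]].
have [i [nKi Ki]] : exists i, ~ K (a ^+ i * z) /\ K (a ^+ i.+1 * z).
  have [N KN] := nilK a Pa.
  apply: contrapT => no; have nK i : ~ K (a ^+ i * z).
    elim: i => [|i IHi]; first by rewrite expr0 mul1r.
    by move=> Ki; apply: no; exists i.
  by apply: (nK N); apply: idMr.
apply: (IH (fun b => K (b * (a ^+ i * z)))) (a ^+ i * z) nKi _ => //.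
- apply: isidealI => [|b c Kb Kc|b c Kc].
  + by rewrite mul0r; apply: id0.
  + by rewrite mulrDl; apply: idD.
  + by rewrite -mulrA; apply: idM.
- by move=> b /LP Kb; rewrite mulrCA; apply: idM.
- by exists a; split; [rewrite mulrA -exprS|move/LP].
Qed.

(** The descending chain condition in the Artinian ring [R_P / K R_P], by Noetherian induction on
    [K]. Adjoining a socle element [z] to [K] gives [K'], with [K'/K] simple at [P]. The saturations
    of [C k + K'] stabilize by induction, and [C k] meets [K'] either in [K] or in all of [K']
    ([alt]), so this intersection stabilizes too. The two together determine [C k]. *)
Lemma saturated_dcc P K : isprime P -> isideal K ->
  (forall s a, ~ P s -> K (s * a) -> K a) ->
  (forall a, P a -> exists N, K (a ^+ N)) ->
  forall C : nat -> R -> Prop, (forall k, isideal (C k)) ->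
  (forall k s a, ~ P s -> C k (s * a) -> C k a) ->
  (forall k a, K a -> C k a) -> (forall k a, C k.+1 a -> C k a) ->
  exists N, forall k a, (N <= k)%N -> C N a -> C k a.
Proof.
move=> pP; have [iP P1 PM] := pP.
move: K; apply: noetherian_ind => // K iK IH satK nilK C iC satC KC decC.
have decC' i j a : (i <= j)%N -> C j a -> C i a.
  by move=> /subnK <-; elim: (j - i)%N => // k IHk /decC.
have [K1|K1] := pselect (K 1).
  by exists 0%N => k a _ _; rewrite -(mulr1 a); apply: idM => //; apply: KC.
have [z [nKz Kz]] := socle iK nilK K1.
pose K' := sat P (adjoin K z).
have iK' : isideal K' by apply/sat_ideal/adjoin_ideal.
have KK' a : K a -> K' a by move=> Ka; apply/sub_sat/sub_adjoin.
have [|||||||||N1 stab] := IH K' _ _ _ _ _ (fun k => sat P (isum (C k) K')) =>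
  //.
- by exists z; split=> //; apply/sub_sat/adjoin_self.
- by move=> s a; apply: sat_sat.
- by move=> a /nilK[N KN]; exists N; apply: KK'.
- by move=> k; apply/sat_ideal/isum_ideal.
- by move=> k s a; apply: sat_sat.
- by move=> k a K'a; apply: sub_sat => //; exists 0; rewrite subr0; split=> //;
  apply: id0.
- by move=> k a [s [Ps [c [Cc K'c]]]]; exists s; split=> //; exists c; split=>
  //; apply: decC.
have alt k : (forall a, C k a -> K' a -> K a) \/ (forall a, K' a -> C k a).
  have [|/existsNP[c /not_implyP[Cc /not_implyP[[s [Ps [r Kr]]] nKc]]]] :=
    pselect (forall a, C k a -> K' a -> K a); first by left.
  right=> a [t [Pt [u Ku]]].
  have nPr : ~ P r.
    move=> /Kz Krz; apply/nKc/(satK s) => //.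
    by rewrite -(subrK (r * z) (s * c)); apply: idD.
  have Cz : C k z.
    apply: (satC k r) => //; have := idM s (iC k) Cc =>
      /(idB (iC k)) /(_ (KC k _ Kr)).
    by rewrite opprB addrC subrK.
  apply: (satC k t) => //; rewrite -(subrK (u * z) (t * a)).
  by apply: idD => //; [apply: KC|apply: idM].
have [N [leN1N NP]] : exists N, (N1 <= N)%N /\
    forall k a, (N <= k)%N -> C N a -> K' a -> C k a.
  have [[k0 k0P]|no] := pselect (exists k0, forall a, C k0 a -> K' a -> K a).
    exists (maxn N1 k0); split=> [|k a _ Ca K'a]; first by rewrite leq_maxl.
    by apply/KC/k0P => //; apply: decC' Ca; rewrite leq_maxr.
  exists N1; split=> // k a _ _ K'a; case: (alt k) => [sub|]; last exact.
  by case: no; exists k.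
exists N => k a leNk Ca.
have [|s [Ps [c [Cc K'c]]]] := stab k a (leq_trans leN1N leNk).
  apply: sub_sat => //; exists a; split; first exact: decC' leN1N _.
  by rewrite subrr; apply: id0.
apply: (satC k s) => //; rewrite -(subrK c (s * a)); apply: idD => //.
apply: NP => //; apply: idB => //; first exact: idM.
exact: decC' leNk _.
Qed.

(* Krull's principal ideal theorem for the prime [P] in [R / P0]; in place of *)
(* symbolic powers of [Q], the contractions to [R] of the ideals              *)
(* [y ^+ n R_Q + P0 R_Q] are used, with [y] in [Q] but not in [P0].           *)
Lemma principal_ideal_theorem P0 Q P x : isprime P0 -> isprime Q -> isprime P ->
  strict P0 Q -> strict Q P -> P x ->
  exists Q', [/\ isprime Q', Q' x, strict P0 Q' & strict Q' P].
Proof.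
move=> pP0 pQ pP [P0Q [y [Qy nP0y]]] [QP [w [Pw nQw]]] Px.
have [Qx|nQx] := pselect (Q x).
  by exists Q; split=> //; split=> //; [exists y|exists w].
apply: contrapT => no.
have [[iP0 P01 P0M] [iQ Q1 QM] [iP P1 PM]] := And3 pP0 pQ pP.
(* Otherwise a prime over [P0 + (x)] that misses all products of a power of [a] with an element
   outside [P] would be strictly between [P0] and [P]. *)
have rad a : P a -> exists N, sat P (adjoin P0 x) (a ^+ N).
  move=> Pa; apply: contrapT => nN; apply: no.
  have [|s t [u [i [Pu ->]]] [v [j [Pv ->]]]| |c Ic [u [i [Pu cE]]]|Q' [pQ' IQ'
    Q'M]] :=
    prime_avoiding (I := adjoin P0 x)
      (M := fun c => exists s i, ~ P s /\ c = s * a ^+ i) accR.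
  - exact: adjoin_ideal.
  - exists (u * v), (i + j)%N; split; first exact: primeCM.
    by rewrite exprD mulrACA.
  - by exists 1, 0%N; rewrite mulr1.
  - by apply: nN; exists i, u; rewrite -cE.
  have Q'x : Q' x by apply/IQ'/adjoin_self.
  exists Q'; split=> //; split.
  - by move=> c P0c; apply/IQ'/sub_adjoin.
  - by exists x; split=> // /P0Q.
  - move=> c Q'c; apply: contrapT => nPc; apply: (Q'M c) => //.
    by exists c, 0%N; rewrite mulr1.
  - exists a; split=> // Q'a; apply: (Q'M a) => //.
    by exists 1, 1%N; rewrite mul1r.
pose I n := sat Q (adjoin P0 (y ^+ n)).
have iI n : isideal (I n) by apply/sat_ideal/adjoin_ideal.
have decI n a : I n.+1 a -> I n a.
  move=> [s [Qs [r P0r]]]; exists s; split=> //; exists (r * y).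
  by rewrite -mulrA -exprS.
have P0I n a : P0 a -> I n a by move=> P0a; apply/sub_sat/sub_adjoin.
have [||||||N stab] := @saturated_dcc P (sat P (adjoin P0 x)) pP _ _ rad
  (fun n => sat P (adjoin (I n) x)).
- exact/sat_ideal/adjoin_ideal.
- by move=> s a; apply: sat_sat.
- by move=> k; apply/sat_ideal/adjoin_ideal.
- by move=> k s a; apply: sat_sat.
- move=> k a [s [Ps Is]]; exists s; split=> //; apply: adjoin_mono Is => c.
  exact: P0I.
- move=> k a [s [Ps Is]]; exists s; split=> //; apply: adjoin_mono Is => c.
  exact: decI.
(* Stationarity writes an element of [I N], locally at [P], as an element of [I N.+1] plus [r * x].
   As [x] is not in [Q] and [I N] is [Q]-saturated, [r] is in [I N]. So Nakayama applies and brings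
   [y ^+ N] into [I N.+1]. *)
have [||||s [Ps [t [Qt [r P0r]]]]] := @nakayama R R^o accR (fun s => ~ P s) x
  (I N.+1) (I N) P1 _ _ (iI _) _ (y ^+ N).
- by move=> s t; apply: primeCM.
- move=> s r Ps Psr; apply: Ps; rewrite -(subrK (r * x) s); apply: idD => //.
  exact: idM.
- move=> t It; have [|s [Ps [r Ir]]] := stab N.+1 t (leqnSn N).
    by apply/sub_sat/sub_adjoin.
  exists s, r; split=> //; last by rewrite /GRing.scale /= (mulrC x).
  have [u [Qu Au]] : I N (x * r).
    rewrite mulrC -(subKr (s * t) (r * x)); apply: (idB (iI N));
      first exact: idM.
    exact: decI.
  by exists (u * x); split; [exact: primeCM|rewrite -mulrA].
- by apply: sub_sat => //; apply: adjoin_self.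
(* Cancelling [y ^+ N] modulo the prime [P0] puts [t * s] in [P0 + (y)], hence in [Q], although
   neither factor is in [Q]. *)
have : P0 (y ^+ N * (t * s - r * y)).
  suff -> : y ^+ N * (t * s - r * y) = t * (s *: (y ^+ N : R^o)) - r * y ^+
    N.+1 by [].
  by rewrite exprS /GRing.scale /=; ring.
move=> /P0M[/(primeX pP0)//|/P0Q Qd].
have : Q (t * s) by rewrite -(subrK (r * y) (t * s)); apply: idD => //;
  apply: idM.
by move=> /QM[//|/QP].
Qed.

Definition chain (P : nat -> R -> Prop) l :=
  (forall i, (i <= l)%N -> isprime (P i)) /\
  (forall i, (i < l)%N -> strict (P i) (P i.+1)).

Lemma chain_rcons (P : nat -> R -> Prop) l Q : chain P l -> isprime Q ->
  strict (P l) Q ->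
  chain (fun i => if (i <= l)%N then P i else Q) l.+1.
Proof.
move=> [pP sP] pQ sQ; split=> i.
  by move=> _ /=; case: leqP => [lei|_ //]; apply: pP.
move=> /[dup]; rewrite {1}ltnS {1}leq_eqVlt => /predU1P[-> _|ltil _].
  by rewrite /= leqnn ltnn.
by rewrite /= ltil ltnW//; apply: sP.
Qed.

Lemma chain_take (P : nat -> R -> Prop) l k : (k <= l)%N -> chain P l ->
  chain P k.
Proof.
move=> lekl [pP sP]; split=> i lei; first exact/pP/(leq_trans lei).
exact/sP/(leq_trans lei).
Qed.

(** The principal ideal theorem, applied to the top three primes, replaces the middle one by a prime
    containing [x]. Repeating this downwards pushes [x] to the bottom, at the cost of one prime. *)
Lemma chain_through x (P : nat -> R -> Prop) l : chain P l.+1 -> P l.+1 x ->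
  exists P' : nat -> R -> Prop, [/\ chain P' l,
    forall a, adjoin (P 0%N) x a -> P' 0%N a & P' l = P l.+1].
Proof.
elim: l P => [|l IHl] P chP Px.
  exists (fun=> P 1%N); split=> //; first by case: chP => pP _; split=> // i _;
    apply: pP.
  move=> a; case: chP => pP sP; have [i1 _ _] := pP 1%N isT.
  by apply: adjoin_sub => //; case: (sP 0%N isT).
have [pP sP] := chP.
have leS : (l <= l.+2)%N := leqW (leqnSn l).
have [Q [pQ Qx sPQ sQP]] :=
  principal_ideal_theorem (pP l leS) (pP l.+1 (leqnSn _))
  (pP l.+2 (leqnn _)) (sP l (leqnSn _)) (sP l.+1 (leqnn _)) Px.
have [|| P' [chP' PP' P'l]] := IHl (fun i => if (i <= l)%N then P i else Q).
- by apply: chain_rcons => //; apply: chain_take chP.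
- by rewrite ltnn.
exists (fun i => if (i <= l)%N then P' i else P l.+2); split=> //.
  by apply: chain_rcons; rewrite // ?P'l ?ltnn//; apply: pP.
by rewrite ltnn.
Qed.

End Primes.

(** * Regular local rings *)

Lemma zero_ideal (R : comNzRingType) : isideal (fun a : R => a = 0).
Proof. by apply: isidealI => // [a b -> ->|a b ->]; rewrite ?addr0 ?mulr0. Qed.

Definition adjoins (R : comNzRingType) (I : R -> Prop) (ys : seq R) :=
  foldl (@adjoin R) I ys.

Fixpoint regular_seq (R : comNzRingType) (I : R -> Prop) (ys : seq R) : Prop :=
  if ys is y :: ys' then
    (forall a, I (y * a) -> I a) /\ regular_seq (adjoin I y) ys'
  else True.

(** Each entry is tested against [I] and all other entries: the earlier ones have already been moved
    into the base ideal. *)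
Fixpoint irredundant_seq (R : comNzRingType) (I : R ->
  Prop) (ys : seq R) : Prop :=
  if ys is y :: ys' then ~ adjoins I ys' y /\ irredundant_seq (adjoin I y) ys'
  else True.

Lemma unit_outside (R : comNzRingType) (m : R -> Prop) s :
  (forall I, isideal I -> ~ I 1 -> forall a, I a -> m a) -> ~ m s ->
  exists t, t * s = 1.
Proof.
move=> sub nms; apply: contrapT => no; apply: nms.
apply: (sub (adjoin (fun a => a = 0) s)).
- exact/adjoin_ideal/zero_ideal.
- by move=> [r /eqP]; rewrite subr_eq0 => /eqP r1; apply: no; exists r.
- by exists 1; rewrite mul1r subrr.
Qed.

Section LocalRings.
Variables (R : comNzRingType) (accR : acc R^o) (m : R -> Prop).
Implicit Types (I J K Q : R -> Prop) (ys : seq R).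

Lemma adjoins_ideal I ys : isideal I -> isideal (adjoins I ys).
Proof. by elim: ys I => //= y ys IHys I iI; apply/IHys/adjoin_ideal. Qed.

Lemma sub_adjoins I ys a : I a -> adjoins I ys a.
Proof. by elim: ys I => //= y ys IHys I Ia; apply/IHys/sub_adjoin. Qed.

Lemma adjoins_mem I ys a : isideal I -> a \in ys -> adjoins I ys a.
Proof.
elim: ys I => //= y ys IHys I iI; rewrite inE => /predU1P[->|].
  exact/sub_adjoins/adjoin_self.
exact/IHys/adjoin_ideal.
Qed.

Lemma adjoins_sub I J ys : isideal J -> (forall a, I a -> J a) ->
  (forall y, y \in ys -> J y) -> forall a, adjoins I ys a -> J a.
Proof.
move=> iJ; elim: ys I => //= y ys IHys I IJ ysJ; apply: IHys.
  by apply: adjoin_sub => //; apply: ysJ; rewrite mem_head.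
by move=> z zys; apply: ysJ; rewrite inE zys orbT.
Qed.

Definition islocal :=
  isprime m /\ forall I, isideal I -> ~ I 1 -> forall a, I a -> m a.

Hypothesis locm : islocal.
Let primem : isprime m. Proof. by case: locm. Qed.
Let idealm : isideal m. Proof. by case: primem. Qed.

Lemma local_unit s : ~ m s -> exists t, t * s = 1.
Proof. by case: locm => _ sub; apply: unit_outside. Qed.

Lemma local_sub1 y r : m y -> exists s, s * (1 - r * y) = 1.
Proof.
move=> my; apply: local_unit => m1; case: primem => _ + _; apply.
by rewrite -(subrK (r * y) 1); apply: idD => //; apply: idM.
Qed.

Lemma prime_sub_local Q : isprime Q -> forall a, Q a -> m a.
Proof. by case=> iQ Q1 _; case: locm => _; apply. Qed.

Lemma chain_top (Q : nat -> R -> Prop) l : chain Q l.+1 ->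
  exists2 Q' : nat -> R -> Prop, chain Q' l.+1 & Q' 0%N = Q 0%N /\ Q' l.+1 = m.
Proof.
move=> [pQ sQ]; exists (fun i => if (i <= l)%N then Q i else m);
  last by rewrite ltnn.
apply: chain_rcons => //.
  by split=> i lei; [apply/pQ/leqW|apply/sQ/leqW].
have [QQ [a [Qa nQa]]] := sQ l (leqnn _).
split; first by apply: prime_sub_local; apply: pQ; rewrite leqnSn.
by exists a; split => //; apply: (prime_sub_local (pQ _ (leqnn _))).
Qed.

Lemma chain_through_local (Q : nat -> R -> Prop) l y : chain Q l.+1 -> m y ->
  exists2 Q' : nat -> R -> Prop, chain Q' l &
    forall a, adjoin (Q 0%N) y a -> Q' 0%N a.
Proof.
move=> /chain_top[Q' chQ' [Q'0 Q'm]] my.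
have [|Q'' [chQ'' sub _]] := chain_through accR chQ' (x := y);
  first by rewrite Q'm.
by exists Q'' => //; rewrite -Q'0.
Qed.

(** Moving one generator into the base ideal shortens the chain by one prime
    ([chain_through_local]). With no generators left, the bottom prime contains [m] and nothing lies
    strictly above it. *)
Lemma height_theorem J ys (Q : nat -> R -> Prop) l : isideal J ->
  (forall y, y \in ys -> m y) -> (forall a, m a -> adjoins J ys a) ->
  chain Q l -> (forall a, J a -> Q 0%N a) -> (l <= size ys)%N.
Proof.
elim: ys J Q l => [|y ys IHys] J Q [|l] iJ ysm mJ chQ JQ //=.
  case: chQ => pQ /(_ 0%N isT)[QQ [a [Qa nQa]]]; case: nQa; apply/JQ/mJ.
  by apply: (prime_sub_local (pQ 1%N isT)).
rewrite ltnS; have my : m y by apply: ysm; rewrite mem_head.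
have [Q' chQ' sub] := chain_through_local chQ my.
apply: (IHys (adjoin J y) Q') => //; first exact: adjoin_ideal.
  by move=> z zys; apply: ysm; rewrite inE zys orbT.
by move=> a /(adjoin_mono JQ); apply: sub.
Qed.

(** A chain as long as the height theorem allows must start at [J]; in particular [J] is prime, as a
    regular local ring is a domain. By the height theorem over [Q 0], [y] is not in [Q 0]. By
    induction [Q 0] lies in [J + (y)], and cancelling [y] modulo [Q 0] gives that [Q 0] lies in
    [J + y Q 0]. Nakayama concludes. *)
Lemma chain_bottom J ys (Q : nat -> R -> Prop) : isideal J ->
  (forall y, y \in ys -> m y) ->
  (forall a, m a -> adjoins J ys a) -> chain Q (size ys) ->
  (forall a, J a -> Q 0%N a) -> forall a, Q 0%N a -> J a.
Proof.
elim: ys J Q => [|y ys IHys] J Q iJ ysm mJ chQ JQ /= a Qa.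
  by apply/mJ/(prime_sub_local _ Qa); case: chQ => + _; apply.
have my : m y by apply: ysm; rewrite mem_head.
have ysm' z : z \in ys -> m z by move=> zys; apply: ysm; rewrite inE zys orbT.
have [iQ Q1 QM] : isprime (Q 0%N) by case: chQ => + _; apply.
have nQy : ~ Q 0%N y.
  move=> Qy; suff: (size ys < size ys)%N by rewrite ltnn.
  apply: (@height_theorem (Q 0%N) ys Q) => // b /mJ; apply: adjoins_sub.
  - exact: adjoins_ideal.
  - by move=> c /JQ; apply: sub_adjoins.
  - move=> z; rewrite inE => /predU1P[->|]; first exact: sub_adjoins.
    exact: adjoins_mem.
have [Q' chQ' sub] := chain_through_local chQ my.
have {sub}QJ b : Q 0%N b -> adjoin J y b.
  move=> Qb; apply: (IHys (adjoin J y) Q') => //.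
  - exact: adjoin_ideal.
  - by move=> c /(adjoin_mono JQ); apply: sub.
  - exact/sub/sub_adjoin.
have [m1 mM] : ~ m 1 /\ forall a b, m (a * b) -> m a \/ m b by case: primem.
have [||t Qt|s [ms Js]] := @nakayama R R^o accR (fun s => ~ m s) y J (Q 0%N)
    m1 _ _ iJ _ a Qa.
- by move=> s t; apply: primeCM.
- move=> s r ms msr; apply: ms; rewrite -(subrK (r * y) s).
  by apply: idD => //; apply: idM.
- have [r Jr] := QJ t Qt; exists 1, r; split=> //.
    have: Q 0%N (r * y).
      by rewrite -(subKr t (r * y)); apply: (idB iQ) => //; apply: JQ.
    by case/QM.
  by rewrite /GRing.scale /= mul1r (mulrC y).
by have [t ts] := local_unit ms; rewrite -(mul1r a) -ts -mulrA; apply: idM.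
Qed.

(** A redundant [y] would leave too few generators for the length of the chain. So [y] is not in
    [J], which is prime by [chain_bottom], and is therefore regular modulo [J]. *)
Lemma regular_seq_chain J ys (Q : nat -> R -> Prop) : isideal J ->
  (forall y, y \in ys -> m y) -> (forall a, J a -> m a) ->
  (forall a, m a -> adjoins J ys a) -> chain Q (size ys) ->
  (forall a, J a -> Q 0%N a) -> regular_seq J ys /\ irredundant_seq J ys.
Proof.
elim: ys J Q => [|y ys IHys] J Q iJ ysm Jm mJ chQ JQ //=.
have my : m y by apply: ysm; rewrite mem_head.
have ysm' z : z \in ys -> m z by move=> zys; apply: ysm; rewrite inE zys orbT.
have QJ := chain_bottom iJ ysm mJ chQ JQ.
have nJy : ~ adjoins J ys y.
  move=> Jy; suff: (size ys < size ys)%N by rewrite ltnn.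
  apply: (@height_theorem J ys Q) => // b /mJ; apply: adjoins_sub.
  - exact: adjoins_ideal.
  - by move=> c; apply: sub_adjoins.
  - move=> z; rewrite inE => /predU1P[-> //|]; exact: adjoins_mem.
have [Q' chQ' sub] := chain_through_local chQ my.
have [||reg irr] := IHys (adjoin J y) Q' (adjoin_ideal y iJ) ysm' _ mJ chQ' _.
- by apply: adjoin_sub.
- by move=> b /(adjoin_mono JQ); apply: sub.
split=> //; split=> // a /JQ; have [iQ Q1 QM] : isprime (Q 0%N) by case: chQ =>
  + _; apply.
by case/QM => /QJ // Jy; case: nJy; apply: sub_adjoins.
Qed.

End LocalRings.

Section Interface.
Variable R : comNzRingType.

Lemma local_ringP (m : {pred R}) : noetherian R -> local_ring m ->
  islocal (fun a => a \in m).
Proof.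
move=> /noetherian_acc accR [[idm maxm] uniqm].
have [m0 m1 mD] := idm.
have idealm : isideal (fun a => a \in m) by split=> // a u v; apply: mD.
have sub I : isideal I -> ~ I 1 -> forall a, I a -> a \in m.
  move: I; apply: noetherian_ind => // I iI IH I1 a Ia.
  pose M : {pred R} := fun b => `[< I b >].
  have M_closed : idealr_closed M.
    split=> [||b u v /asboolP Iu /asboolP Iv]; first by apply/asboolP/(id0 iI).
      by apply/negP => /asboolP.
    by apply/asboolP; case: iI => _; apply.
  have [maxM|nmaxM] := pselect (maximal_ideal M).
    by rewrite -(uniqm M maxM); apply/asboolP.
  have [J [[J0 J1 JD] [IJ [b [Jb nIb]]]]] : exists J : {pred R},
    idealr_closed J /\
      (forall a, I a -> a \in J) /\ exists b, b \in J /\ ~ I b.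
    apply: contrapT => no; apply: nmaxM; split=> // J cJ IJ b.
    apply/idP/idP => [Jb|/IJ //]; apply/asboolP; apply: contrapT => nIb.
    apply: no; exists J; split=> //; split; last by exists b.
    by move=> c Ic; apply: IJ; apply/asboolP.
  have iJ : isideal (fun c => c \in J) by split=> // c u v; apply: JD.
  by apply: (IH _ iJ IJ _ _ a (IJ a Ia)); [exists b|apply/negP].
split=> //; split=> //; first exact/negP.
move=> a b mab; apply: contrapT => /not_orP[nma nmb].
have [/(unit_outside sub)[c ca] /(unit_outside sub)[d db]] := (nma, nmb).
case/negP: m1; have -> : 1 = c * d * (a * b) by rewrite mulrACA ca db mulr1.
exact: (@idM _ (fun a => a \in m)).
Qed.

Lemma regular_local_ringP (m : {pred R}) : regular_local_ring m ->
  exists ys : seq R, [/\ forall a, a \in m <-> adjoins (fun a => a = 0) ys a,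
    regular_seq (fun a => a = 0) ys & irredundant_seq (fun a => a = 0) ys].
Proof.
move=> [noethR locR [d [[[P [pP sP]] _] [x xP]]]].
have locm := local_ringP noethR locR.
have accR := noetherian_acc noethR.
have iz := zero_ideal R.
have [idealm _ _] : isprime (fun a => a \in m) by case: locm.
pose ys := codom x.
have ysm y : y \in ys -> y \in m.
  move=> /codomP[i ->]; apply/xP; exists (fun j => (j == i)%:R).
  rewrite (bigD1 i)//= eqxx mul1r big1 ?addr0// => j /negPf ->.
  by rewrite mul0r.
have mys a : a \in m <-> adjoins (fun a => a = 0) ys a.
  split; last first.
    by apply: (@adjoins_sub _ _ (fun a => a \in m)) => // b ->;
      apply: (id0 idealm).
  move=> /xP[c ->]; apply: id_sum; first exact: adjoins_ideal.
  move=> i _; apply: idM; first exact: adjoins_ideal.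
  by apply: adjoins_mem => //; apply: codom_f.
have sz : size ys = d by rewrite size_codom card_ord.
have [] := @regular_seq_chain _ accR _ locm (fun a => a = 0) ys
  (fun i a => a \in P i) iz ysm.
- by move=> a ->; apply: (id0 idealm).
- by move=> a /mys.
- rewrite sz; split=> i lei.
    have [[P0 P1 PD] PM] := pP i lei; split; last by move=> a b /PM/orP.
      by split=> // a u v; apply: PD.
    exact/negP.
  have [sub nsub] := sP i lei; split=> //; apply: contrapT => no; apply: nsub.
  move=> a Pa; apply/negPn/negP => /negP nPa; apply: no; exists a; split=> //.
- move=> a ->; have [[P0 _ _] _] := pP 0%N isT; exact: P0.
by exists ys.
Qed.

End Interface.

(** * Equational flatness *)

Section MatricesModuloIdeal.
Variables (R : comNzRingType) (K : R -> Prop) (iK : isideal K).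

Definition mxin (L : R -> Prop) p q (M : 'M[R]_(p, q)) := forall i j, L (M i j).

Lemma mxin0 p q : mxin K (0 : 'M[R]_(p, q)).
Proof. by move=> i j; rewrite mxE; apply: id0. Qed.

Lemma mxinD p q (M N : 'M[R]_(p, q)) : mxin K M -> mxin K N -> mxin K (M + N).
Proof. by move=> KM KN i j; rewrite mxE; apply: idD. Qed.

Lemma mxinB p q (M N : 'M[R]_(p, q)) : mxin K M -> mxin K N -> mxin K (M - N).
Proof. by move=> KM KN i j; rewrite !mxE; apply: idB. Qed.

Lemma mxinZ p q a (M : 'M[R]_(p, q)) : mxin K M -> mxin K (a *: M).
Proof. by move=> KM i j; rewrite mxE; apply: idM. Qed.

Lemma mxin_mull p q r (M : 'M[R]_(p, q)) (N : 'M[R]_(q, r)) :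
  mxin K N -> mxin K (M *m N).
Proof. by move=> KN i j; rewrite mxE; apply: id_sum => // k _; apply: idM. Qed.

Lemma mxin_mulr p q r (M : 'M[R]_(p, q)) (N : 'M[R]_(q, r)) :
  mxin K M -> mxin K (M *m N).
Proof. by move=> KM i j; rewrite mxE; apply: id_sum => // k _; apply: idMr. Qed.

Lemma mxin_row p q r (M : 'M[R]_(p, q)) (N : 'M[R]_(p, r)) :
  mxin K M -> mxin K N -> mxin K (row_mx M N).
Proof. by move=> KM KN i j; rewrite mxE; case: splitP. Qed.

Lemma mxin_sub (L : R -> Prop) p q (M : 'M[R]_(p, q)) :
  (forall a, K a -> L a) -> mxin K M -> mxin L M.
Proof. by move=> KL KM i j; apply: KL. Qed.

Lemma mxin_adjoin x p q (M : 'M[R]_(p, q)) :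
  mxin (adjoin K x) M <-> exists N, mxin K (M - x *: N).
Proof.
split=> [KM|[N KN] i j]; last by exists (N i j); move: (KN i j);
  rewrite !mxE mulrC.
have [h hP] := choice (fun ij : 'I_p * 'I_q => KM ij.1 ij.2).
exists (\matrix_(i, j) h (i, j)) => i j; rewrite !mxE mulrC; exact: (hP (i, j)).
Qed.

Lemma adjoinX_mul x k a : adjoin K (x ^+ k) a -> adjoin K (x ^+ k.+1) (x * a).
Proof.
move=> [r Kr]; exists r.
have -> : x * a - r * x ^+ k.+1 = x * (a - r * x ^+ k) by rewrite exprS; ring.
exact: idM.
Qed.

Lemma mxin_adjoinX_mul x k p q (M : 'M[R]_(p, q)) :
  mxin (adjoin K (x ^+ k)) M -> mxin (adjoin K (x ^+ k.+1)) (x *: M).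
Proof. by move=> KM i j; rewrite mxE; apply: adjoinX_mul. Qed.

Lemma regularX x k p q (M : 'M[R]_(p, q)) : (forall a, K (x * a) -> K a) ->
  mxin K (x ^+ k *: M) -> mxin K M.
Proof.
move=> reg; elim: k => [|k IHk]; first by rewrite expr0 scale1r.
rewrite exprS -scalerA => KM; apply: IHk => i j.
by apply: reg; move: (KM i j); rewrite mxE.
Qed.

Lemma adjoinX_le x j k a : (j <= k)%N -> adjoin K (x ^+ k) a ->
  adjoin K (x ^+ j) a.
Proof.
by move=> lejk [r Kr]; exists (r * x ^+ (k - j)); rewrite -mulrA -exprD subnK.
Qed.

End MatricesModuloIdeal.
Arguments mxin_adjoin {R K x p q M}.

Lemma acc_col (R : comNzRingType) n : acc R^o -> acc 'cV[R]_n.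
Proof.
move=> accR; elim: n => [|n IHn] C sC incC.
  by exists 0%N => k v _; rewrite (flatmx0 v); case: (sC 0%N).
have leC := chain_le incC.
pose C' k (v : 'cV[R]_(1 + n)) := C k v.
have sC' k : submodule (C' k) := sC k.
have [k|k v|N1 N1P] := IHn (fun k v => C' k (col_mx 0 v)).
- split=> [|a u v Cu Cv]; first by rewrite col_mx0; case: (sC' k).
  have -> : col_mx 0 (a *: u + v) = a *: col_mx 0 u + col_mx 0 v :> 'cV[R]_(1 +
    n).
    by rewrite scale_col_mx add_col_mx scaler0 addr0.
  by case: (sC' k) => _; apply.
- exact: incC.
have [k|k s [v Cv]|N2 N2P] := accR (fun k s => exists v, C' k (col_mx s%:M v)).
- split=> [|a s t [u Cu] [v Cv]]; first by exists 0; rewrite raddf0 col_mx0;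
  case: (sC' k).
  exists (a *: u + v).
  have -> : col_mx (a *: s + t)%:M (a *: u + v)
      = a *: col_mx s%:M u + col_mx t%:M v :> 'cV[R]_(1 + n).
    by rewrite scale_col_mx add_col_mx raddfD /= scale_scalar_mx.
  by case: (sC' k) => _; apply.
- by exists v; apply: incC.
suff main k (v : 'cV[R]_(1 + n)) : C' k v -> C' (maxn N1 N2) v.
  by exists (maxn N1 N2); apply: main.
move=> Cv.
have [|v' Cv'] := N2P k (usubmx v 0 0).
  by exists (dsubmx v); rewrite -mx11_scalar vsubmxK.
have {}Cv' : C' (maxn N1 N2) (col_mx (usubmx v) v').
  by move: Cv'; rewrite -mx11_scalar; apply: leC; rewrite leq_maxr.
apply: (sm_congr (sC' _) _ Cv');
  rewrite -[X in X - _]vsubmxK opp_col_mx add_col_mx subrr.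
apply: (leC N1); first by rewrite leq_maxl.
apply: (N1P (maxn k (maxn N1 N2))).
have -> : col_mx 0 (dsubmx v - v') = v - col_mx (usubmx v) v' :> 'cV[R]_(1 + n).
  by rewrite -[X in _ = X - _]vsubmxK opp_col_mx add_col_mx subrr.
apply: (smB (sC' _)); first by apply: leC Cv; rewrite leq_maxl.
by apply: leC Cv'; rewrite leq_maxr.
Qed.

Ltac mxlin := rewrite ?(mulmxDl, mulmxDr, mulmxBl, mulmxBr, scalerDr, scalerBr,
    scalerDl, scalerBl, scalerN, mulmxN, mulNmx, =^~ scalemxAl, =^~ scalemxAr,
      scalerA, mulmxA);
  repeat match goal with |- context [?X *m ?Y] =>
    let p := fresh "p" in set p := X *m Y; clearbody p end;
  apply/matrixP => ? ?; rewrite !mxE; ring.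

Section EquationalFlatness.
Variables (A B : comNzRingType) (f : {rmorphism A -> B}).
Implicit Types (J : A -> Prop) (K : B -> Prop).
Local Notation "M ^f" := (map_mx f M) : ring_scope.

(* Equational form of the flatness of B / K over A / J. *)
Definition eqflat J K := forall n (a : 'rV[A]_n) (b : 'cV[B]_n),
  mxin K (a^f *m b) -> exists r (V : 'M[A]_(n, r)) (g : 'cV[B]_r),
    mxin K (b - V^f *m g) /\ mxin J (a *m V).

Lemma mxin_map J K p q (M : 'M[A]_(p, q)) : (forall a, J a -> K (f a)) ->
  mxin J M -> mxin K M^f.
Proof. by move=> JK JM i j; rewrite mxE; apply: JK. Qed.

(** Over a field an equation is either trivial or can be solved for a variable whose coefficient
    [a 0 j] is invertible; [V] is the resulting projection onto the solutions. *)
Lemma eqflat_local m K : isideal m -> isideal K ->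
  (forall s, ~ m s -> exists t, t * s = 1) -> eqflat m K.
Proof.
move=> im iK unit_m n a b Kab.
have [ma|/existsNP[i /existsNP[j]]] := pselect (mxin m a).
  exists n, 1%:M, b; rewrite map_mx1 mul1mx subrr mulmx1.
  by split=> //; apply: mxin0.
rewrite ord1 => /unit_m[t tP].
have aE : a *m delta_mx j 0 = (a 0 j)%:M :> 'M[A]_1.
  by apply/matrixP => k l; rewrite !ord1 -colE !mxE.
exists n, (1%:M - t *: (delta_mx j (0 : 'I_1) *m a)), b; split.
  rewrite map_mxB map_mx1 map_mxZ map_mxM /= mulmxBl mul1mx subKr -scalemxAl
    -mulmxA.
  by apply: mxinZ => //; apply: mxin_mull.
rewrite mulmxBr mulmx1 -scalemxAr mulmxA aE mul_scalar_mx scalerA tP scale1r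
  subrr.
exact: mxin0.
Qed.

Section Step.
Variables (J : A -> Prop) (K : B -> Prop) (iJ : isideal J) (iK : isideal K).
Variable x : A.
Hypothesis sub_f : forall a, J a -> K (f a).
Hypothesis reg : forall b, K (f x * b) -> K b.
Hypothesis eqf : eqflat (adjoin J x) (adjoin K (f x)).

(** Solving modulo [x] gives [b = V bet + x b'] and [a V = x rho]. Regularity of [f x] allows
    division by [x], and [(bet, b')] then solves the equation with coefficients [(rho, a)] modulo
    [x^M]. The induction hypothesis solves that one, and substituting back gains one power of
    [x]. *)
Lemma eqflat_adjoinX M : eqflat (adjoin J (x ^+ M)) (adjoin K (f x ^+ M)).
Proof.
elim: M => [|M IHM] n a b.
  move=> _; exists n, 1%:M, b; rewrite map_mx1 mul1mx subrr mulmx1; split=> i j.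
    by rewrite mxE; apply: (id0 (adjoin_ideal _ iK)).
  by exists (a i j); rewrite expr0 mulr1 subrr; apply: id0.
move=> Kab.
have [|r [V [bet [/mxin_adjoin[b' Kb'] /mxin_adjoin[rho Jrho]]]]] := @eqf n a b.
  move=> i j; rewrite -[f x]expr1; exact: adjoinX_le (Kab i j).
have /mxin_adjoin[c Kc] := Kab.
have [|l [U [gam]]] := IHM _ (row_mx rho a) (col_mx bet b').
  apply/mxin_adjoin; exists c; rewrite map_row_mx mul_row_col.
  apply: (regularX (k := 1) reg); rewrite expr1.
  have -> : f x *: (rho^f *m bet + a^f *m b' - f x ^+ M *: c)
      = (a^f *m b - f x ^+ M.+1 *: c) - a^f *m (b - V^f *m bet - f x *: b')
        - (a *m V - x *: rho)^f *m bet.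
    by rewrite map_mxB map_mxZ map_mxM /= exprS; mxlin.
  apply: mxinB => //; last by apply: mxin_mulr => //; apply: mxin_map Jrho.
  by apply: mxinB => //; apply: mxin_mull.
rewrite -[U]vsubmxK map_col_mx mul_col_mx opp_col_mx add_col_mx mul_row_col.
set U1 := usubmx U; set U2 := dsubmx U.
move=> [Kcol /mxin_adjoin[y JU]].
have /mxin_adjoin[del Kdel] : mxin (adjoin K (f x ^+ M)) (bet - U1^f *m gam).
  by move=> i j; move: (Kcol (lshift n i) j); rewrite col_mxEu.
have KU2 : mxin (adjoin K (f x ^+ M)) (b' - U2^f *m gam).
  by move=> i j; move: (Kcol (rshift r i) j); rewrite col_mxEd.
exists (l + r)%N, (row_mx (V *m U1 + x *: U2) (x ^+ M *: V)), (col_mx gam del);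
  split.
  have -> : b - (row_mx (V *m U1 + x *: U2) (x ^+ M *: V))^f *m col_mx gam del
      = (b - V^f *m bet - f x *: b') + V^f *m (bet - U1^f *m gam - f x ^+ M *:
        del)
        + f x *: (b' - U2^f *m gam).
    rewrite map_row_mx mul_row_col map_mxD !map_mxZ map_mxM /= rmorphXn.
    by mxlin.
  apply: mxinD; [exact: adjoin_ideal| |exact: mxin_adjoinX_mul].
  apply: mxin_sub (sub_adjoin _) _.
  by apply: mxinD => //; apply: mxin_mull.
rewrite mul_mx_row; apply: mxin_row.
  have -> : a *m (V *m U1 + x *: U2)
      = (a *m V - x *: rho) *m U1 + x *: (rho *m U1 + a *m U2) by mxlin.
  apply: mxinD; [exact: adjoin_ideal| |].
    by apply: mxin_sub (sub_adjoin _) _; apply: mxin_mulr.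
  by apply: mxin_adjoinX_mul => //; apply/mxin_adjoin; exists y.
apply/mxin_adjoin; exists rho.
have -> : a *m (x ^+ M *: V) - x ^+ M.+1 *: rho = x ^+ M *: (a *m V - x *: rho).
  by rewrite exprSr; mxlin.
exact: mxinZ.
Qed.

(** The span, modulo [K], of the solutions of [a] over [A/J], isolated as a submodule of [B^n] so
    that Krull's intersection theorem applies to it. *)
Definition eqspan n (v : 'cV[B]_n) (a : 'rV[A]_n) :=
  exists r (V : 'M[A]_(n, r)) (g : 'cV[B]_r),
    mxin K (v - V^f *m g) /\ mxin J (a *m V).

Lemma eqspan_submodule n (a : 'rV[A]_n) : submodule (fun v => eqspan v a).
Proof.
split=> [|s u v [r [V [g [Kg Ja]]]] [r' [V' [g' [Kg' Ja']]]]].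
  exists 0%N, 0, 0; rewrite mulmx0 subrr mulmx0.
  by split=> [i j|i []//]; rewrite mxE; apply: id0.
exists (r + r')%N, (row_mx V V'), (col_mx (s *: g) g'); split; last first.
  by rewrite mul_mx_row; apply: mxin_row.
have -> : s *: u + v - (row_mx V V')^f *m col_mx (s *: g) g'
    = s *: (u - V^f *m g) + (v - V'^f *m g').
  by rewrite map_row_mx mul_row_col; mxlin.
by apply: mxinD => //; apply: mxinZ.
Qed.

Hypothesis accA : acc A^o.
Hypothesis accB : acc B^o.
Hypothesis unit_x : forall r, exists s, s * (1 - r * f x) = 1.

(** A solution [b] is approximated by the span of honest solutions up to [x^N B^n] for every [N];
    Krull's intersection theorem then removes the error. *)
Lemma eqflat_lift : eqflat J K.
Proof.
move=> n a b Kab.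
pose I y := exists c : 'cV[A]_n, J (y - (a *m c) 0 0).
have iI : isideal I.
  apply: isidealI => [|y z [c Jc] [d Jd]|y z [c Jc]].
  - by exists 0; rewrite mulmx0 mxE subr0; apply: id0.
  - exists (c + d); rewrite mulmxDr mxE opprD addrACA; exact: idD.
  - by exists (y *: c); rewrite -scalemxAr mxE -mulrBr; apply: idM.
have [k0 k0P] := colon_stable accA x iI.
apply: (krull_intersection (acc_col (n :=
  n) accB) (eqspan_submodule a) unit_x) => N.
have [|r [V [g [/mxin_adjoin[b' Kb'] /mxin_adjoin[y Jy]]]]] :=
  @eqflat_adjoinX (N + k0) n a b.
  by apply: mxin_sub Kab => c; apply: sub_adjoin.
(* [V] solves [a] only up to [x^(N + k0) y]. That error lies in [I = J + a A^n], so by the choice of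
   [k0] already [x^k0 y] is [a C] modulo [J], and [V - x^N C] is an exact solution modulo [J]. *)
have [C CP] : exists C : 'M[A]_(n, r), mxin J (x ^+ k0 *: y - a *m C).
  have Iy j : I (x ^+ k0 * y 0 j).
    apply: (k0P (N + k0)%N); exists (col j V).
    have -> : (a *m col j V) 0 0 = (a *m V) 0 j.
      by rewrite !mxE; apply: eq_bigr => i _; rewrite mxE.
    have -> : x ^+ (N + k0) *: (y 0 j : A^o) - (a *m V) 0 j
        = - (a *m V - x ^+ (N + k0) *: y) 0 j.
      by rewrite !mxE opprB.
    by rewrite -mulN1r; apply: idM.
  have [h hP] := choice Iy.
  exists (\matrix_(i, j) h j i 0) => i j; move: (hP j); rewrite !ord1 !mxE.
  by under [X in _ -> J (_ - X)]eq_bigr do rewrite mxE.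
exists (f x ^+ k0 *: b' + C^f *m g), r, (V - x ^+ N *: C), g; split.
  have -> : b - f x ^+ N *: (f x ^+ k0 *: b' + C^f *m g) - (V - x ^+ N *: C)^f
    *m g
      = b - V^f *m g - f x ^+ (N + k0) *: b'.
    by rewrite map_mxB map_mxZ rmorphXn exprD; mxlin.
  exact: Kb'.
have -> : a *m (V - x ^+ N *: C)
    = (a *m V - x ^+ (N + k0) *: y) + x ^+ N *: (x ^+ k0 *: y - a *m C).
  by rewrite exprD; mxlin.
by apply: mxinD => //; apply: mxinZ.
Qed.
End Step.

(** As [y] is regular, [B / (K + y^(k+1))] is filtered with quotients [B / (K + y)], and flatness
    passes to extensions. The bound by [q] keeps the image of [J] inside [K + y^(k+1)]. *)
Lemma eqflat_power J K (y : B) q : isideal J -> isideal K ->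
  (forall b, K (y * b) -> K b) -> (forall a, J a -> adjoin K (y ^+ q) (f a)) ->
  eqflat J (adjoin K y) ->
  forall k, (k < q)%N -> eqflat J (adjoin K (y ^+ k.+1)).
Proof.
move=> iJ iK reg sub_f eqf; elim=> [|k IHk] ltkq n a b; first by rewrite expr1;
  apply: eqf.
move=> Kab; have [|r [V [g [/mxin_adjoin[b' Kb'] JV]]]] :=
  IHk (ltnW ltkq) n a b.
  by move=> i j; apply: adjoinX_le (Kab i j).
have fJV : mxin (adjoin K (y ^+ k.+2)) (a *m V)^f.
  move=> i j; rewrite mxE; apply: (adjoinX_le (k := q)) => //.
  exact/sub_f/JV.
have [c Kc] : exists c, mxin K (y ^+ k.+1 *: (a^f *m b') - y ^+ k.+2 *: c).
  apply/mxin_adjoin.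
  have -> : y ^+ k.+1 *: (a^f *m b')
      = a^f *m b - a^f *m (b - V^f *m g - y ^+ k.+1 *: b') - (a *m V)^f *m g.
    by rewrite map_mxM; mxlin.
  have iKy := adjoin_ideal (y ^+ k.+2) iK.
  apply: mxinB => //; last exact: mxin_mulr.
  apply: mxinB => //; apply: mxin_sub (sub_adjoin _) _; exact: mxin_mull.
have [|r' [U [h [/mxin_adjoin[b'' Kb''] JU]]]] := eqf n a b'.
  apply/mxin_adjoin; exists c; apply: (regularX (k := k.+1) reg).
  by rewrite scalerBr scalerA -exprSr.
exists (r + r')%N, (row_mx V U), (col_mx g (y ^+ k.+1 *: h)); split; last first.
  by rewrite mul_mx_row; apply: mxin_row.
apply/mxin_adjoin; exists b''.
have -> : b - (row_mx V U)^f *m col_mx g (y ^+ k.+1 *: h) - y ^+ k.+2 *: b''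
    = (b - V^f *m g - y ^+ k.+1 *: b') + y ^+ k.+1 *: (b' - U^f *m h - y *:
      b'').
  by rewrite map_row_mx mul_row_col [y ^+ k.+2]exprSr; mxlin.
by apply: mxinD => //; apply: mxinZ.
Qed.

End EquationalFlatness.

Section Relations.
Variables (A B : comNzRingType) (f : {rmorphism A -> B}).
Variables (J : A -> Prop) (K : B -> Prop) (iJ : isideal J) (iK : isideal K).
Local Notation "M ^f" := (map_mx f M) : ring_scope.

(** From one equation to a finite system: the parametrization found so far is substituted into the
    next relation, which [eqflat] solves in the parameters. The start is the identity matrix indexed
    by [L]. *)
Lemma eqflat_relations (T : choiceType) (rep : T -> B) (L : seq T)
    (rels : seq (seq (A * T))) :
  eqflat f J K ->
  (forall rel, rel \in rels -> forall ct, ct \in rel -> ct.2 \in L) ->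
  (forall rel, rel \in rels -> K (\sum_(ct <- rel) f ct.1 * rep ct.2)) ->
  exists r (u : T -> 'I_r -> A) (g : 'I_r -> B),
    (forall t, t \in L -> K (rep t - \sum_j f (u t j) * g j)) /\
    (forall rel, rel \in rels -> forall j,
      J (\sum_(ct <- rel) ct.1 * u ct.2 j)).
Proof.
move=> eqf; elim: rels => [|rel rels IHrels] relL relK.
  exists (size L), (fun t (j : 'I_(size L)) => (index t L == j :> nat)%:R),
    (fun j => rep (tnth (in_tuple L) j)).
  split=> // t tL; move: (tL); rewrite -index_mem => ltt.
  rewrite (bigD1 (Ordinal ltt)) //= eqxx rmorph1 mul1r big1 => [|j /eqP neqj].
    by rewrite addr0 (tnth_nth t) /= nth_index // subrr; apply: id0.
  by case: eqP => [e|_]; [case: neqj; apply: val_inj;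
    rewrite /= e|rewrite rmorph0 mul0r].
have [rel' relin|rel' relin|r [u [g [Kg Ju]]]] := IHrels.
- by apply: relL; rewrite inE relin orbT.
- by apply: relK; rewrite inE relin orbT.
pose a : 'rV[A]_r := \row_j \sum_(ct <- rel) ct.1 * u ct.2 j.
have [|s [V [h [Kh JV]]]] := eqf r a (\col_j g j).
  move=> i j; rewrite mxE.
  have -> : \sum_k (a^f) i k * (\col_j g j) k j
      = \sum_(ct <- rel) f ct.1 * (\sum_k f (u ct.2 k) * g k).
    under eq_bigr do rewrite !mxE rmorph_sum mulr_suml.
    rewrite exchange_big; apply: eq_bigr => ct _; rewrite mulr_sumr.
    by apply: eq_bigr => k _; rewrite rmorphM mulrA.
  have Krel := relK rel (mem_head _ _).
  rewrite -[X in K X](subKr (\sum_(ct <- rel) f ct.1 * rep ct.2)).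
  apply: idB => //; rewrite -sumrB big_seq; apply: id_sum => // ct ctin.
  rewrite -mulrBr; apply: idM => //; apply: Kg.
  exact: relL (mem_head _ _) _ ctin.
exists s, (fun t j => \sum_k u t k * V k j), (fun j => h j 0); split=>
  [t tL|rel'].
  have -> : rep t - \sum_j f (\sum_k u t k * V k j) * h j 0
      = (rep t - \sum_k f (u t k) * g k)
        + \sum_k f (u t k) * (\col_j g j - V^f *m h) k 0.
    under [X in _ = _ + X]eq_bigr do rewrite !mxE mulrBr.
    rewrite sumrB addrA subrK; congr (_ - _).
    under eq_bigr do rewrite rmorph_sum mulr_suml.
    rewrite exchange_big; apply: eq_bigr => k _; rewrite mulr_sumr.
    by apply: eq_bigr => j _; rewrite rmorphM mxE mulrA.
  apply: idD => //; first exact: Kg.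
  by apply: id_sum => // k _; apply: idM.
have E rel0 j : \sum_(ct <- rel0) ct.1 * (\sum_k u ct.2 k * V k j)
    = \sum_k (\sum_(ct <- rel0) ct.1 * u ct.2 k) * V k j.
  under [RHS]eq_bigr do rewrite mulr_suml.
  rewrite exchange_big; apply: eq_bigr => ct _; rewrite mulr_sumr.
  by apply: eq_bigr => k _; rewrite mulrA.
rewrite inE => /predU1P[-> j|rin j]; rewrite E.
  by move: (JV 0 j); rewrite mxE; under eq_bigr do rewrite mxE.
by apply: id_sum => // k _; apply: idMr => //; apply: Ju.
Qed.
End Relations.

(** * Vanishing of tensors *)

Section TensorVanishing.
Variables (R S : comNzRingType) (phi : {rmorphism R -> S}).
Variables (M : lmodType R) (N : lmodType S).
Local Notation F := {freeg (M * N)%type}.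

Lemma tpure_sum_eq0 (l : seq (M * N)) :
  \sum_(z <- l) tpure phi z.1 z.2 = 0 ->
    tens_rel phi (\sum_(z <- l) << z >> : F).
Proof.
move=> l0; suff: (\sum_(z <- l) << z >> - 0 : F) \in @tens_pred _ _ phi M N.
  by rewrite subr0 => /asboolP.
rewrite Quotient.idealrBE; apply/eqP; rewrite raddf0 raddf_sum -[RHS]l0.
by apply: eq_bigr => -[].
Qed.

Let value (u : N -> R) (x : F) : M :=
  fglift (fun z : (M * N)%type => u z.2 *: z.1 : zmodule M) x.

Let valueB u x y : value u (x - y) = value u x - value u y.
Proof.
exact: (lift_is_additive (fun z : (M * N)%type => u z.2 *: z.1 : zmodule M)).
Qed.
Let valueU u m n : value u << (m, n) >> = u n *: m.
Proof. by rewrite /value liftU scale1r. Qed.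

(* The vanishing of a tensor only uses finitely many linear relations in the  *)
(* second factor, which can then be lifted by equational flatness.            *)
Lemma tens_rel_relations (x : F) : tens_rel phi x ->
  exists rels : seq (seq (R * N)),
    (forall rel, rel \in rels -> \sum_(cn <- rel) phi cn.1 *: cn.2 = 0) /\
    forall (J : R -> Prop) (Z : M -> Prop), submodule Z ->
      (forall a m, J a -> Z (a *: m)) -> forall u : N -> R,
      (forall rel, rel \in rels -> J (\sum_(cn <- rel) cn.1 * u cn.2)) ->
      Z (value u x).
Proof.
elim=> {x}[|x y _ [rx [rx0 xP]] _ [ry [ry0 yP]]|m m' n|m n n'|a m n].
- exists [::]; split=> // J Z sZ _ u _.
  by rewrite -(subrr (0 : F)) valueB subrr; case: sZ.
- exists (rx ++ ry); split=> [rel|J Z sZ JZ u uP].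
    by rewrite mem_cat => /orP[/rx0|/ry0].
  rewrite valueB.
  by apply: (smB sZ (xP J Z sZ JZ u _) (yP J Z sZ JZ u _)) => rel relin;
    apply: uP; rewrite mem_cat relin ?orbT.
- exists [::]; split=> // J Z sZ _ u _.
  rewrite !valueB !valueU scalerDr (addrC (u n *: m)) addrK subrr; by case: sZ.
- exists [:: [:: (1, n + n'); (-1, n); (-1, n')]]; split=> [rel|J Z sZ JZ u uP].
    rewrite inE => /eqP ->; rewrite !big_cons big_nil /= rmorphN rmorph1.
    by rewrite !scaleN1r scale1r addr0 -opprD subrr.
  rewrite !valueB !valueU -!scalerBl; apply: JZ.
  move: (uP _ (mem_head _ _)); rewrite !big_cons big_nil /= !mulN1r mul1r addr0.
  by rewrite addrA.
- exists [:: [:: (1, phi a *: n); (- a, n)]]; split=> [rel|J Z sZ JZ u uP].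
    rewrite inE => /eqP ->; rewrite !big_cons big_nil /= rmorphN rmorph1.
    by rewrite scaleNr scale1r addr0 subrr.
  rewrite !valueB !valueU scalerA -!scalerBl.
  rewrite -opprB scaleNr; apply: smN => //; apply: JZ.
  move: (uP _ (mem_head _ _)); rewrite !big_cons big_nil /= mul1r addr0.
  by rewrite mulNr (mulrC a).
Qed.

(** On the finitely many vectors that witness the vanishing, a function [u] satisfying [rels] modulo
    [J] behaves like a linear map to [R/J], so evaluating the tensor along [u] gives zero in
    [M/Z]. *)
Lemma tens_vanishing (l : seq (M * N)) : \sum_(z <- l) tpure phi z.1 z.2 = 0 ->
  exists rels : seq (seq (R * N)),
    (forall rel, rel \in rels -> \sum_(cn <- rel) phi cn.1 *: cn.2 = 0) /\
    forall (J : R -> Prop) (Z : M -> Prop), submodule Z ->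
      (forall a m, J a -> Z (a *: m)) -> forall u : N -> R,
      (forall rel, rel \in rels -> J (\sum_(cn <- rel) cn.1 * u cn.2)) ->
      Z (\sum_(z <- l) u z.2 *: z.1).
Proof.
move=> /tpure_sum_eq0/tens_rel_relations[rels [rels0 relsP]].
exists rels; split=> // J Z sZ JZ u uP.
suff <- : value u (\sum_(z <- l) << z >>) = \sum_(z <- l) u z.2 *: z.1 by
  apply: (relsP J).
have value0 : value u 0 = 0 by rewrite -(subrr (0 : F)) valueB subrr.
have valueD x y : value u (x + y) = value u x + value u y.
  by rewrite -{1}[y]opprK valueB -(sub0r y) valueB value0 sub0r opprK.
elim: l {relsP} => [|[m n] l IHl]; first by rewrite !big_nil.
by rewrite !big_cons valueD IHl valueU.
Qed.

Lemma tens_sum (t : tens phi M N) :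
  exists l : seq (M * N), t = \sum_(z <- l) tpure phi z.1 z.2.
Proof.
elim/tens_ind: t => [m n||x y [l ->] [l' ->]].
- by exists [:: (m, n)]; rewrite big_seq1.
- by exists [::]; rewrite big_nil.
exists (l ++ [seq (- z.1, z.2) | z <- l']).
rewrite big_cat big_map /= -sumrN; congr (_ + _).
by apply: eq_bigr => z _; rewrite tpureNl.
Qed.

Lemma tpure_suml (I : Type) (s : seq I) (F' : I -> M) (n : N) :
  tpure phi (\sum_(i <- s) F' i) n = \sum_(i <- s) tpure phi (F' i) n.
Proof.
by elim: s => [|i s IHs]; rewrite ?big_nil ?tpure0l// !big_cons tpureDl IHs.
Qed.

Lemma tpure0r (m : M) : tpure phi m (0 : N) = 0.
Proof. by apply: (addIr (tpure phi m 0)); rewrite -tpureDr !add0r. Qed.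

Lemma tpure_sumr (I : Type) (s : seq I) (F' : I -> N) (m : M) :
  tpure phi m (\sum_(i <- s) F' i) = \sum_(i <- s) tpure phi m (F' i).
Proof.
by elim: s => [|i s IHs]; rewrite ?big_nil ?tpure0r// !big_cons tpureDr IHs.
Qed.

End TensorVanishing.

Section Swap.
Variables (A : comNzRingType) (M N : lmodType A).

Let swap : tens idfun M N -> tens idfun N M :=
  tlift (fun m n => tpure idfun n m).

Let swap_balanced : balanced idfun (fun (m : M) (n : N) => tpure idfun n m).
Proof. by split=> *; rewrite ?tpureDl ?tpureDr// tpureZ. Qed.

Lemma tens_swap_eq0 (l : seq (M * N)) :
  \sum_(z <- l) tpure idfun z.1 z.2 = 0 ->
    \sum_(z <- l) tpure idfun z.2 z.1 = 0.
Proof.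
have swap0 : swap 0 = 0 by have := tliftB swap_balanced 0 0; rewrite !subrr.
have swapN x : swap (- x) = - swap x.
  by have := tliftB swap_balanced 0 x; rewrite -/swap swap0 !sub0r.
move=> l0; rewrite -[RHS]swap0 -l0; elim: l {l0} => [|[m n] l IHl].
  by rewrite !big_nil.
rewrite !big_cons IHl -[X in swap (_ + X)]opprK.
rewrite [RHS](tliftB swap_balanced) -/swap swapN opprK; congr (_ + _).
by rewrite /swap tlift_tpure.
Qed.
End Swap.

Lemma eqflat_flat_hom (A B : comNzRingType) (f : {rmorphism A -> B}) :
  eqflat f (fun a => a = 0) (fun b => b = 0) -> flat_hom f.
Proof.
move=> eqf N N' g inj_g t1 t2 /eqP; rewrite -subr_eq0 -raddfB => /eqP.
move=> gt0; apply/eqP; rewrite -subr_eq0; apply/eqP; move: gt0.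
have [l ->] := tens_sum (t1 - t2); rewrite raddf_sum => gl0.
pose l' : seq (resscal f B^o * N') := [seq (z.1, g z.2) | z <- l].
have {}gl0 : \sum_(z <- l') tpure idfun z.1 z.2 = 0.
  by rewrite big_map -[RHS]gl0; apply: eq_bigr => z _;
    rewrite /= tens_map_tpure.
(* The factors are swapped so that the relations obtained are between elements of [B]. Factoring
   these through solutions [u] over [A] leaves, for each [j], a relation in [N'] that injectivity of
   [g] pulls back to [N]. *)
have [|rels [rels0 relsP]] :=
  @tens_vanishing A A idfun N' (resscal f B^o) [seq (z.2, z.1) | z <- l'].
  by rewrite big_map; apply: tens_swap_eq0.
pose L : seq B :=
  [seq z.1 | z <- l] ++ flatten [seq [seq cb.2 | cb <- rel] | rel <- rels].
have [rel relin cb cbin|rel relin|r [u [h [hP uP]]]] :=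
  @eqflat_relations A B f _ _ (zero_ideal A) (zero_ideal B) B id L rels eqf.
- rewrite mem_cat; apply/orP; right; apply/flattenP.
  by exists [seq cb.2 | cb <- rel]; apply: map_f.
- exact: rels0.
have ul0 j : \sum_(z <- l) u z.1 j *: z.2 = 0.
  have gul0 : \sum_(z <- l) u z.1 j *: g z.2 = 0.
    have Z0 : submodule (fun v : N' => v = 0).
      by split=> // a v w -> ->; rewrite scaler0 addr0.
    have := relsP (fun a => a = 0) _ Z0 _ (fun b => u b j).
    rewrite !big_map; apply=> [a v ->|rel relin]; first by rewrite scale0r.
    exact: uP.
  apply: inj_g; rewrite raddf0 raddf_sum -[RHS]gul0.
  by apply: eq_bigr => z _; apply: linearZ.
transitivity (\sum_(z <- l) \sum_j tpure idfun (h j : resscal f B^o) (u z.1 j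
  *: z.2)).
  rewrite big_seq [RHS]big_seq; apply: eq_bigr => z zl.
  have /eqP : z.1 - \sum_j f (u z.1 j) * h j = 0.
    by apply: hP; rewrite mem_cat map_f.
  rewrite subr_eq0 => /eqP {1}->.
  rewrite -[X in tpure _ X _]/(\sum_j (u z.1 j *: (h j : resscal f B^o))).
  by rewrite tpure_suml; apply: eq_bigr => j _; rewrite tpureZ.
rewrite exchange_big big1 // => j _.
by rewrite -tpure_sumr ul0 tpure0r.
Qed.

(** * The module [A/J] and the extended ideal [JB] *)

Section QuotientModule.
Variables (A : comNzRingType) (J : A -> Prop) (iJ : isideal J).

(* The proof is an argument so that the zmodClosed instance can be inferred.  *)
Definition ideal_pred (_ : isideal J) : {pred A} := fun a => `[< J a >].

Fact ideal_pred_zmod : zmod_closed (ideal_pred iJ).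
Proof.
split; first by apply/asboolP; apply: id0.
by move=> a b /asboolP Ja /asboolP Jb; apply/asboolP; apply: idB.
Qed.
HB.instance Definition _ :=
  GRing.isZmodClosed.Build A (ideal_pred iJ) ideal_pred_zmod.

Definition quotmod : Type := {ideal_quot (ideal_pred iJ)}.
HB.instance Definition _ := GRing.Zmodule.on quotmod.

Definition qpi (a : A) : quotmod := \pi_{ideal_quot (ideal_pred iJ)} a.
Definition qrepr (w : quotmod) : A := repr (w : {ideal_quot (ideal_pred iJ)}).

Lemma qreprK w : qpi (qrepr w) = w. Proof. exact: reprK. Qed.

Lemma qpi_eq a b : qpi a = qpi b <-> J (a - b).
Proof.
have := Quotient.idealrBE (ideal_pred iJ) a b => E.
split=> [/eqP|Jab]; first by rewrite /qpi -E => /asboolP.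
by apply/eqP; rewrite /qpi -E; apply/asboolP.
Qed.

Lemma qpiD a b : qpi (a + b) = qpi a + qpi b.
Proof. exact: raddfD. Qed.

Lemma qpi0 : qpi 0 = 0.
Proof. exact: raddf0. Qed.

Let scale (a : A) (w : quotmod) : quotmod := qpi (a * qrepr w).

Let scaleE a b : scale a (qpi b) = qpi (a * b).
Proof.
by apply/qpi_eq; rewrite -mulrBr; apply: idM => //; apply/qpi_eq/qreprK.
Qed.
Let scaleA a b v : scale a (scale b v) = scale (a * b) v.
Proof. by rewrite -[v]qreprK !scaleE mulrA. Qed.
Let scale1 : left_id 1 scale.
Proof. by move=> v; rewrite -[v]qreprK scaleE mul1r. Qed.
Let scaleDr : right_distributive scale +%R.
Proof.
by move=> a u v; rewrite -[u]qreprK -[v]qreprK -qpiD !scaleE mulrDr qpiD.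
Qed.
Let scaleDl v : {morph scale^~ v : a b / a + b}.
Proof. by move=> a b; rewrite -[v]qreprK !scaleE mulrDl qpiD. Qed.

HB.instance Definition _ :=
  GRing.Zmodule_isLmodule.Build A quotmod scaleA scale1 scaleDr scaleDl.

Lemma qpiZ a b : a *: qpi b = qpi (a * b).
Proof. exact: scaleE. Qed.

End QuotientModule.

(** The ideal [JB] as the intersection of all ideals containing the image of [J], so that membership
    serves directly as an induction principle. *)
Definition extension (A B : comNzRingType) (f : A -> B) (J : A ->
  Prop) (b : B) :=
  forall K : B -> Prop, isideal K -> (forall a, J a -> K (f a)) -> K b.

Section Extension.
Variables (A B : comNzRingType) (f : {rmorphism A -> B}).

Lemma extension_ideal J : isideal (extension f J).
Proof.
apply: isidealI => [|a b Ja Jb|a b Jb] K iK JK.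
- exact: id0.
- by apply: idD => //; [apply: Ja|apply: Jb].
- by apply: idM => //; apply: Jb.
Qed.

Lemma sub_extension (J : A -> Prop) a : J a -> extension f J (f a).
Proof. by move=> Ja K _; apply. Qed.

Lemma extension_adjoin (J : A -> Prop) x b : isideal J ->
  extension f (adjoin J x) b <-> adjoin (extension f J) (f x) b.
Proof.
move=> iJ; split=> [Jb|[c Jc] K iK JK].
  apply: Jb => [|a [r Jr]]; first exact/adjoin_ideal/extension_ideal.
  by exists (f r); rewrite -rmorphM -rmorphB; apply: sub_extension.
rewrite -(subrK (c * f x) b); apply: idD => //; last first.
  by apply: idM => //; apply/JK/adjoin_self.
by apply: Jc => // a Ja; apply/JK/sub_adjoin.
Qed.
End Extension.

(** * Pure Radu-Andre homomorphisms *)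

Section Dumitrescu.
Variables (p : nat) (A B : comNzRingType) (chA : p \in [pchar A]).
Variables (f : {rmorphism A -> B}) (e : nat).
Variables (J : A -> Prop) (iJ : isideal J).
Local Notation F := (frobenius chA e).
Local Notation RB := (resscal f B^o).
Local Notation W := (quotmod iJ).

(** Induces the canonical map from [W ⊗ (B ⊗_F A)] to [B ⊗_F W]. *)
Let assoc (w : W) : radu_andre_source chA f e -> tens F RB W :=
  tlift (fun (b : RB) (a : A^o) => tpure F b ((a : A) *: w)).

Let assoc_balanced w :
  @balanced _ _ F RB A^o (tens F RB W) (fun b a => tpure F b ((a : A) *: w)).
Proof.
split=> [b b' a|b a a'|c b a]; rewrite ?tpureDl ?scalerDl ?tpureDr//.
by rewrite tpureZ scalerA.
Qed.

Let assocE w b a :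
  assoc w (@tpure _ _ F RB A^o b a) = @tpure _ _ F RB W b ((a : A) *: w).
Proof. exact/tlift_tpure/assoc_balanced. Qed.

Let assocB w : {morph assoc w : x y / x - y}.
Proof. exact/tliftB/assoc_balanced. Qed.

Let assoc0 w : assoc w 0 = 0.
Proof. by rewrite -(subrr 0) assocB subrr. Qed.

Let assoc_bal : balanced idfun assoc.
Proof.
split=> [w w' s|w s s'|c w s].
- elim/tens_ind: s => [b a||x y hx hy].
  + by rewrite !assocE scalerDr tpureDr.
  + by rewrite !assoc0 addr0.
  + by rewrite !assocB hx hy opprD addrACA.
- have assocN x : assoc w (- x) = - assoc w x by rewrite -sub0r assocB assoc0
  sub0r.
  by rewrite -{1}[s']opprK assocB assocN opprK.
- elim/tens_ind: s => [b a||x y hx hy].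
  + by rewrite tpureZr !assocE scalerA mulrC.
  + by rewrite scaler0 !assoc0.
  + by rewrite scalerBr !assocB hx hy.
Qed.

Let tpure_extension (b : B) : extension f J b ->
  tpure idfun (qpi iJ 1) (b : RB) = 0.
Proof.
move=> Jb; rewrite -[b]mul1r; move: (1 : B); apply: (Jb (fun c => forall c',
  tpure idfun (qpi iJ 1) (c' * c : RB) = 0)) => [|a Ja c'].
  apply: isidealI => [c'|c d hc hd c'|c d hd c'].
  - by rewrite mulr0 tpure0r.
  - by rewrite mulrDr (tpureDr idfun _ (c' * c : RB)) hc hd addr0.
  - by rewrite mulrA.
rewrite mulrC -[X in tpure _ _ X]/(a *: (c' : RB)) -[LHS]tpureZ qpiZ mulr1.
have -> : qpi iJ a = 0 by rewrite -qpi0; apply/qpi_eq; rewrite subr0.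
by rewrite tpure0l.
Qed.

(** That is, [y] lies in [J + I^[q]] with [I] the annihilator of [b] in [B/JB]. Purity, tested on
    [A/J], makes [b ⊗ y] vanish in [B ⊗_F A/J]; the finitely many relations responsible are lifted
    along the flat [F]. *)
Lemma pure_radu_andre_relations (b : B) (y : A) :
  pure (radu_andre chA f e) -> eqflat F J J -> extension f J (b * f y) ->
  exists r (u g : 'I_r -> A), J (y - \sum_j u j ^+ (p ^ e) * g j) /\
    forall j, extension f J (f (u j) * b).
Proof.
move=> pure_f eqF Jby; have iE := extension_ideal f J.
have q_gt0 : (0 < p ^ e)%N by rewrite expn_gt0 prime_gt0// (pcharf_prime chA).
have by0 : tpure idfun (qpi iJ 1) (tpure F (b : RB) (y : A^o)) = 0.
  apply: (pure_f W); rewrite raddf0 tens_map_tpure /= radu_andre_tpure.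
  apply: tpure_extension; rewrite -(prednK q_gt0) exprSr -mulrA.
  exact: (idM _ iE Jby).
have {}by0 : tpure F (b : RB) (y *: qpi iJ 1) = 0.
  rewrite -assocE -[LHS](tlift_tpure assoc_bal) by0.
  by have := tliftB assoc_bal 0 0; rewrite !subrr.
have [|rels [rels0 relsP]] := @tens_vanishing _ _ F RB W [:: (b : RB,
  y *: qpi iJ 1)].
  by rewrite big_seq1.
pose L := y *: qpi iJ 1 :: flatten [seq [seq cw.2 | cw <- rel] | rel <- rels].
have [rel relin cw cwin|rel relin|r [u [g [gP uP]]]] :=
  @eqflat_relations A A F J J iJ iJ W (@qrepr A J iJ) L rels eqF.
- rewrite inE; apply/orP; right; apply/flattenP.
  by exists [seq cw.2 | cw <- rel]; apply: map_f.
- rewrite -[X in J X]subr0; apply/(qpi_eq iJ);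
  rewrite qpi0 -[RHS](rels0 rel relin).
  elim: rel {relin} => [|[c w] rel IHrel]; first by rewrite !big_nil qpi0.
  by rewrite !big_cons qpiD IHrel -qpiZ qreprK.
exists r, (u (y *: qpi iJ 1)), g; split=> [|j].
  have Jy : J (y - qrepr (y *: qpi iJ 1)).
    by apply/(qpi_eq iJ); rewrite qreprK qpiZ mulr1.
  have := idD iJ Jy (gP _ (mem_head _ _)).
  by rewrite addrA subrK.
have := relsP J (extension f J) _ _ (u^~ j); rewrite big_seq1; apply.
- split=> [|a c d Jc Jd]; first exact: (id0 iE).
  exact: (idD iE (idM (f a) iE Jc) Jd).
- by move=> a c Ja; apply: (idMr _ iE); apply: sub_extension.
- by move=> rel relin; apply: uP.
Qed.
End Dumitrescu.

(** * Descent along the regular sequence *)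

Section RegularBase.
Variables (p : nat) (A : comNzRingType) (chA : p \in [pchar A]).
Variables (m : A -> Prop) (accA : acc A^o) (locm : islocal m).
Implicit Types (J : A -> Prop) (ys : seq A).

(** Since [F y = y^q], [eqflat_lift] asks for flatness of [A/(J + y^q)] over [A/(J + y)];
    [eqflat_power] derives it from the flatness of [F] on [A/(J + y)], which is the induction
    hypothesis. *)
Lemma frobenius_eqflat e J ys : isideal J -> (forall a, m a <->
  adjoins J ys a) ->
  regular_seq J ys -> eqflat (frobenius chA e) J J.
Proof.
elim: ys J => [|y ys IHys] J iJ mE /=.
  by move=> _; apply: eqflat_local => // s nJs; apply: (local_unit locm) => /mE.
move=> [regy regys].
have my : m y by apply/mE/adjoins_mem => //; apply: mem_head.
have q_gt0 : (0 < p ^ e)%N by rewrite expn_gt0 prime_gt0// (pcharf_prime chA).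
have FE a : frobenius chA e a = a ^+ (p ^ e) by [].
have JF a : J a -> J (frobenius chA e a).
  by move=> Ja; rewrite /= FE -(prednK q_gt0) exprSr; apply: idM.
have [[idealm _ _] _] := locm.
have iJy := adjoin_ideal y iJ.
apply: (@eqflat_lift _ _ _ _ _ iJ iJ y) => //.
- move=> a; rewrite /= FE; elim: (p ^ e)%N => [|k IHk]; first by rewrite mul1r.
  by rewrite exprS -mulrA => /regy.
- rewrite /= FE -(prednK q_gt0); apply: (@eqflat_power _ _ _ _ _ y (p ^ e)) =>
  //.
  + move=> a [r Jr]; exists (frobenius chA e r).
    by rewrite -FE -rmorphM -rmorphB; apply: JF.
  + exact: IHys.
  + by rewrite prednK.
- move=> r; apply: (local_sub1 locm); rewrite /= FE -(prednK q_gt0) exprSr.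
  exact: idM.
Qed.

Variables (B : comNzRingType) (n : B ->
  Prop) (accB : acc B^o) (locn : islocal n).
Variables (f : {rmorphism A -> B}) (e : nat).
Hypothesis f_local : forall a, m a -> n (f a).
Hypothesis e_gt0 : (0 < e)%N.
Hypothesis pure_f : pure (radu_andre chA f e).

Lemma extension_regular J y ys b : isideal J ->
  (forall a, m a <-> adjoins J (y :: ys) a) -> regular_seq J (y :: ys) ->
  ~ adjoins J ys y -> extension f J (f y * b) -> extension f J b.
Proof.
move=> iJ mE reg irr; rewrite mulrC => Jby; apply: contrapT => nJb.
have iE := extension_ideal f J.
have my : m y by apply/mE/adjoins_mem => //; apply: mem_head.
have eqF : eqflat (frobenius chA e) J J := frobenius_eqflat iJ mE reg.
have [r [u [g [Jy uP]]]] := pure_radu_andre_relations iJ pure_f eqF Jby.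
have mu j : m (u j).
  have [_ sub] := locm; apply: (sub (fun a => extension f J (f a * b))) => //.
  - apply: isidealI => [|a c Ja Jc|a c Jc].
    + by rewrite rmorph0 mul0r; apply: (id0 iE).
    + by rewrite rmorphD mulrDl; apply: (idD iE).
    + by rewrite rmorphM -mulrA; apply: (idM _ iE).
  - by rewrite rmorph1 mul1r.
have iL : isideal (adjoins J ys) by apply: adjoins_ideal.
(* Here [e > 0] matters: each [u j] is [s y] modulo the other generators, and [q >= 2] puts its
   [q]-th power in [(y^2)] modulo them. *)
have q_gt1 : (1 < p ^ e)%N.
  have := prime_gt1 (pcharf_prime chA) => p1.
  by rewrite -(exp1n e) ltn_exp2r.
have square j : adjoin (adjoins J ys) (y ^+ 2) (u j ^+ (p ^ e)).
  have [s Ls] : adjoin (adjoins J ys) y (u j).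
    have /mE := mu j; apply: adjoins_sub; first exact: adjoin_ideal.
      by move=> a Ja; apply/sub_adjoin/sub_adjoins.
    move=> z; rewrite inE => /predU1P[->|zys]; first exact: adjoin_self.
    by apply: sub_adjoin; apply: adjoins_mem.
  rewrite -(subnK q_gt1) exprD; apply: idM; first exact: adjoin_ideal.
  exists (s ^+ 2).
  have -> : u j ^+ 2 - s ^+ 2 * y ^+ 2 = (u j + s * y) * (u j - s * y) by ring.
  exact: idM.
have [c Lc] : adjoin (adjoins J ys) (y ^+ 2) y.
  rewrite -[X in adjoin _ _ X](subrK (\sum_j u j ^+ (p ^ e) * g j)).
  have iLy := adjoin_ideal (y ^+ 2) iL.
  apply: idD => //; first exact/sub_adjoin/sub_adjoins.
  by apply: id_sum => // j _; apply: idMr.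
have [s sE] := local_sub1 locm c my.
apply: irr; rewrite -[y]mul1r -sE.
have -> : s * (1 - c * y) * y = s * (y - c * y ^+ 2) by ring.
exact: idM.
Qed.

(** Each step of the descent is [eqflat_lift] with [K = JB]: [extension_regular] supplies the
    regularity of [y], and [(J + y)B = JB + f(y)B] matches the induction hypothesis. *)
Lemma extension_eqflat J ys : isideal J -> (forall a, m a <-> adjoins J ys a) ->
  regular_seq J ys -> irredundant_seq J ys -> eqflat f J (extension f J).
Proof.
elim: ys J => [|y ys IHys] J iJ mE.
  move=> _ _; apply: eqflat_local => //; first exact: extension_ideal.
  by move=> s nJs; apply: (local_unit locm) => /mE.
move=> reg [irry irrys]; have iE := extension_ideal f J.
apply: (@eqflat_lift _ _ _ _ _ iJ iE y) => //.
- by move=> a; apply: sub_extension.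
- by move=> b; apply: extension_regular reg irry.
- have <- : extension f (adjoin J y) = adjoin (extension f J) (f y).
    by apply/funext => b; apply/propext/extension_adjoin.
  by apply: IHys irrys; [apply: adjoin_ideal| |case: reg].
- move=> r; apply: (local_sub1 locn); apply: f_local.
  by apply/mE/adjoins_mem => //; apply: mem_head.
Qed.

End RegularBase.

Theorem corollary2p23 (p : nat) (A B : comNzRingType)
    (m : {pred A}) (n : {pred B}) (f : {rmorphism A -> B})
    (chA : p \in [pchar A]) (chB : p \in [pchar B])
    (noethA : noetherian A) (noethB : noetherian B)
    (locA : local_ring m) (locB : local_ring n) (locf : local_hom m n f)
    (dumf : dumitrescu chA f) (regA : regular_local_ring m) :
  flat_hom f.
Proof.
have [ys [mE reg irr]] := regular_local_ringP regA.
have eqf := extension_eqflat (noetherian_acc noethA) (local_ringP noethA locA)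
  (noetherian_acc noethB) (local_ringP noethB locB) locf (ltnSn 0)
  (dumf 1%N (ltnSn 0)) (zero_ideal A) mE reg irr.
apply: eqflat_flat_hom.
have <- : extension f (fun a => a = 0) = (fun b => b = 0); last exact: eqf.
apply/funext => b; apply/propext; split=> [|->].
  by move=> /(_ _ (zero_ideal B)); apply=> a ->; apply: rmorph0.
exact: (id0 (extension_ideal f _)).
Qed.
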